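(* The following two statements are equivalent. (A) For each permutation $\pi$, the polynomial $\sum_{\sigma\in s^{-1}(\pi)}x^{\mathrm{des}(\sigma)+1}$ has only real roots (and is, therefore, log-concave). (B) For each $k\geq 0$ and each integral binary nestohedron $P\subseteq\mathbb R^{k+1}$, the polynomial $\sum_{\mathbf q\in P\cap\mathbb Z^{k+1}}N_{\mathbf q}(x)$ has only real roots (and is, therefore, log-concave).
   Context: A permutation is an ordering, written in one-line notation, of a finite set of positive integers. West's stack-sorting map $s$ sends the empty permutation to itself, and if $\pi=LmR$ is a nonempty permutation with largest entry $m$, then $s(\pi)=s(L)\,s(R)\,m$. $\mathrm{des}(\sigma)$ is the number of indices $i$ with $\sigma_i>\sigma_{i+1}$. The zero polynomial (which arises in (A) when $s^{-1}(\pi)=\emptyset$) is regarded as having only real roots. The Narayana polynomials are $N_n(x)=\sum_{i=1}^n\frac1n\binom ni\binom n{i-1}x^i$ for $n\ge 1$; for $\mathbf q=(q_0,\ldots,q_k)\in\mathbb Z_{>0}^{k+1}$, $N_{\mathbf q}(x)=\prod_{i=0}^kN_{q_i}(x)$. A binary building set on $[k+1]=\{1,\ldots,k+1\}$ is a collection $\mathcal B$ of nonempty subsets of $[k+1]$ such that every set in $\mathcal B$ is an interval $\{i,i+1,\ldots,j\}$, every singleton subset of $[k+1]$ is in $\mathcal B$, and any two non-disjoint $I,J\in\mathcal B$ satisfy $I\subseteq J$ or $J\subseteq I$. For $I\subseteq[k+1]$ let $\Delta_I=\mathrm{conv}(\{e_i:i\in I\})\subseteq\mathbb R^{k+1}$,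 with $e_1,\ldots,e_{k+1}$ the standard basis. A binary nestohedron in $\mathbb R^{k+1}$ is a Minkowski sum $\sum_{I\in\mathcal B}y_I\Delta_I$, where $\mathcal B$ is a binary building set on $[k+1]$ and every $y_I$ is a positive real number. It is integral if all its vertices are in $\mathbb Z^{k+1}$ (all lattice points of an integral binary nestohedron then have positive coordinates). *)

(* Defs.v *)
From HB Require Import structures.
From mathcomp Require Import all_boot all_order all_algebra.
From mathcomp Require Import all_classical all_reals.
From mathcomp Require Import complex.

Set Implicit Arguments.
Unset Strict Implicit.
Unset Printing Implicit Defensive.

Import Order.TTheory GRing.Theory Num.Theory.

Local Open Scope classical_set_scope.
Local Open Scope ring_scope.

Definition real_rooted (R : realType) (p : {poly R}) : Prop :=
  p = 0 \/ forall z : R[i], root (map_poly (real_complex R) p) z -> complex.Im z = 0.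

Definition log_concave (R : realType) (p : {poly R}) : Prop :=
  forall i : nat, p`_i * p`_i.+2 <= p`_i.+1 ^+ 2.

Definition is_permutation (s : seq nat) : Prop := uniq s && all (leq 1) s.

(* n is fuel; see stack_sort_cat for the recursion s(L m R) = s(L) s(R) m. *)
Fixpoint stack_sort_rec (n : nat) (s : seq nat) : seq nat :=
  match n, s with
  | n'.+1, _ :: _ =>
      let m := (\max_(x <- s) x)%N in
      let j := index m s in
      stack_sort_rec n' (take j s) ++ stack_sort_rec n' (drop j.+1 s) ++ [:: m]
  | _, _ => [::]
  end.

Definition stack_sort (s : seq nat) : seq nat := stack_sort_rec (size s) s.

Definition des (s : seq nat) : nat :=
  count (fun i => nth 0%N s i > nth 0%N s i.+1)%N (iota 0 (size s).-1).

Definition stack_preimage (p : seq nat) : set (seq nat) :=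
  [set s | is_permutation s /\ stack_sort s = p].

(* \sum_(i \in A) is 0 when the support is infinite; stack_preimage_finite
   below excludes this case. *)
Definition preimage_poly (R : realType) (p : seq nat) : {poly R} :=
  \sum_(s \in stack_preimage p) ('X^((des s).+1) : {poly R}).

Definition narayana (R : realType) (n : nat) : {poly R} :=
  \sum_(1 <= i < n.+1) (n%:R^-1 * 'C(n, i)%:R * 'C(n, i.-1)%:R) *: 'X^i.

(* The coordinates are only ever positive here (see lattice_points_gt0), so
   that absz is the identification of positive integers with naturals. *)
Definition narayana_prod (R : realType) (k : nat) (q : 'rV[int]_k.+1) : {poly R} :=
  \prod_(i < k.+1) narayana R (absz (q 0 i)).

(* The ground set [k+1] is 'I_k.+1, with indices starting at 0. *)
Definition is_interval (k : nat) (I : {set 'I_k.+1}) : Prop :=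
  exists i j : 'I_k.+1, I = [set l : 'I_k.+1 | (i <= l <= j)%N]%SET.

Definition binary_building_set (k : nat) (B : {set {set 'I_k.+1}}) : Prop :=
  [/\ forall I, I \in B -> I != finset.set0,
      forall I, I \in B -> is_interval I,
      forall i, [set i]%SET \in B
    & forall I J, I \in B -> J \in B -> ~~ [disjoint I & J] ->
        I \subset J \/ J \subset I].

Definition simplex (R : realType) (k : nat) (I : {set 'I_k.+1}) : set 'rV[R]_k.+1 :=
  [set x | exists w : 'I_k.+1 -> R,
     [/\ forall i, i \in I -> 0 <= w i,
         \sum_(i in I) w i = 1
       & x = \sum_(i in I) w i *: delta_mx 0 i]].

Definition weighted_minkowski_sum (R : realType) (k : nat)
    (B : {set {set 'I_k.+1}}) (y : {set 'I_k.+1} -> R) : set 'rV[R]_k.+1 :=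
  [set x | exists v : {set 'I_k.+1} -> 'rV[R]_k.+1,
     (forall I, I \in B -> simplex I (v I)) /\ x = \sum_(I in B) y I *: v I].

Definition binary_nestohedron (R : realType) (k : nat) (P : set 'rV[R]_k.+1) : Prop :=
  exists (B : {set {set 'I_k.+1}}) (y : {set 'I_k.+1} -> R),
    [/\ binary_building_set B, forall I, I \in B -> 0 < y I
      & P = weighted_minkowski_sum B y].

(* A vertex is a face consisting of a single point, i.e. the unique maximizer
   over P of some linear functional. *)
Definition is_vertex (R : realType) (k : nat) (P : set 'rV[R]_k.+1)
    (x : 'rV[R]_k.+1) : Prop :=
  P x /\ exists c : 'cV[R]_k.+1,
    forall z, P z -> z <> x -> (z *m c) 0 0 < (x *m c) 0 0.

Definition integral_binary_nestohedron (R : realType) (k : nat)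
    (P : set 'rV[R]_k.+1) : Prop :=
  binary_nestohedron P /\
  forall x, is_vertex P x -> exists q : 'rV[int]_k.+1, x = map_mx intr q.

Definition lattice_points (R : realType) (k : nat) (P : set 'rV[R]_k.+1) :
    set 'rV[int]_k.+1 :=
  [set q | P (map_mx intr q)].

(* As above, the sum is finite by lattice_points_finite. *)
Definition lattice_poly (R : realType) (k : nat) (P : set 'rV[R]_k.+1) : {poly R} :=
  \sum_(q \in lattice_points P) narayana_prod R q.

Lemma max_split (L R : seq nat) (m : nat) :
  all (fun x => x < m)%N L -> all (fun x => x < m)%N R ->
  (\max_(x <- L ++ m :: R) x)%N = m.
Proof.
move=> /allP hL /allP hR; apply/eqP; rewrite eqn_leq; apply/andP; split.
  apply/bigmax_leqP_seq => x; rewrite mem_cat inE => /or3P[/hL/ltnW//|/eqP->//|].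
  by move=> /hR/ltnW.
by rewrite (@leq_bigmax_seq _ (L ++ m :: R) xpredT id) // mem_cat mem_head orbT.
Qed.

Lemma max_mem (x : nat) (s : seq nat) : (\max_(y <- x :: s) y)%N \in x :: s.
Proof.
elim: s x => [|y s IH] x; first by rewrite big_seq1 mem_head.
rewrite big_cons; set M := (\max_(z <- y :: s) z)%N.
have hM : M \in y :: s by exact: IH.
rewrite inE /maxn; case: ifP => _; first by rewrite hM orbT.
by rewrite eqxx.
Qed.

Lemma stack_sort_rec_fuel (n : nat) (s : seq nat) :
  (size s <= n)%N -> stack_sort_rec n s = stack_sort s.
Proof.
rewrite /stack_sort.
suff H n1 n2 t : (size t <= n1)%N -> (size t <= n2)%N ->
    stack_sort_rec n1 t = stack_sort_rec n2 t by move=> h; exact: H.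
elim: n1 n2 t => [|n1 IH] [|n2] [|x t] //= h1 h2.
set m := bigop _ _ _; set j := index m (x :: t).
have hj : (j < size (x :: t))%N by rewrite index_mem max_mem.
congr (_ ++ (_ ++ _)); apply: IH.
- by rewrite -ltnS (leq_trans _ h1)// size_takel// ltnW.
- by rewrite -ltnS (leq_trans _ h2)// size_takel// ltnW.
- by rewrite size_drop (leq_trans (leq_subr _ _)).
- by rewrite size_drop (leq_trans (leq_subr _ _)).
Qed.

Lemma stack_sort_nil : stack_sort [::] = [::].
Proof. by []. Qed.

Lemma stack_sort_cat (L R : seq nat) (m : nat) :
  all (fun x => x < m)%N L -> all (fun x => x < m)%N R ->
  stack_sort (L ++ m :: R) = stack_sort L ++ stack_sort R ++ [:: m].
Proof.
move=> hL hR.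
have mL : m \notin L by apply/negP => /(allP hL); rewrite ltnn.
have E : index m (L ++ m :: R) = size L.
  by rewrite index_cat (negbTE mL) /= eqxx addn0.
rewrite {1}/stack_sort size_cat /= addnS /=.
case EL : (L ++ m :: R) => [|a t]; first by case: (L) EL.
rewrite -EL max_split// E take_size_cat// drop_cat ltnNge leqnSn /=.
by rewrite subSnn /= drop0 !stack_sort_rec_fuel ?leq_addl ?leq_addr.
Qed.

Lemma perm_stack_sort (s : seq nat) : perm_eq (stack_sort s) s.
Proof.
rewrite /stack_sort.
suff H n t : (size t <= n)%N -> perm_eq (stack_sort_rec n t) t by exact: H.
elim: n t => [|n IH] [|x t] //= h.
set m := bigop _ _ _; set j := index m (x :: t).
have mt : m \in x :: t by exact: max_mem.
have hj : (j < size (x :: t))%N by rewrite index_mem.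
have E : x :: t = take j (x :: t) ++ m :: drop j.+1 (x :: t).
  by rewrite -{1}(cat_take_drop j (x :: t)) (drop_nth m hj) nth_index.
rewrite [X in perm_eq _ X]E -/(drop j.+1 (x :: t)); apply: perm_cat.
  by apply: IH; rewrite -ltnS (leq_trans _ h)// size_takel// ltnW.
rewrite cats1 perm_rcons perm_cons; apply: IH.
by rewrite size_drop (leq_trans (leq_subr _ _)).
Qed.

Lemma stack_preimage_finite (p : seq nat) : finite_set (stack_preimage p).
Proof.
apply: (@sub_finite_set _ _ [set` permutations p]) => [s /= [_ <-]|].
  by rewrite mem_permutations perm_sym perm_stack_sort.
exact: finite_seq.
Qed.

Lemma simplex_ge0 (R : realType) (k : nat) (I : {set 'I_k.+1}) (x : 'rV[R]_k.+1)
  (i : 'I_k.+1) : simplex I x -> 0 <= x 0 i <= 1.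
Proof.
move=> [w [w0 w1 ->]].
have -> : (\sum_(j in I) w j *: delta_mx 0 j : 'rV_k.+1) 0 i
          = \sum_(j in I) w j * (i == j)%:R.
  by rewrite summxE; apply: eq_bigr => j _; rewrite !mxE eqxx.
apply/andP; split; first by apply: sumr_ge0 => j /w0 h; rewrite mulr_ge0.
rewrite -[leRHS]w1; apply: ler_sum => j /w0 h.
by case: (i == j); rewrite ?mulr1 ?mulr0.
Qed.

Lemma lattice_points_gt0 (R : realType) (k : nat) (P : set 'rV[R]_k.+1)
  (q : 'rV[int]_k.+1) (i : 'I_k.+1) :
  binary_nestohedron P -> lattice_points P q -> 0 < q 0 i.
Proof.
move=> [B [y [[_ _ hs _] y0 ->]]] [v [hv]] /(congr1 (fun z : 'rV[R]__ => z 0 i)).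
rewrite mxE summxE => E; rewrite -(ltr0z R) E (bigD1 [set i]%SET) //=.
apply: ltr_pwDl; last first.
  apply: sumr_ge0 => I /andP[IB _]; rewrite mxE mulr_ge0 //; first exact/ltW/y0.
  by have /andP[] := simplex_ge0 i (hv _ IB).
have [w [_ w1 ->]] := hv _ (hs i).
by move: w1; rewrite !big_set1 => ->; rewrite !mxE !eqxx !mulr1 y0.
Qed.

Lemma lattice_points_finite (R : realType) (k : nat) (P : set 'rV[R]_k.+1) :
  binary_nestohedron P -> finite_set (lattice_points P).
Proof.
move=> hP; have [B [y [hB y0 EP]]] := hP.
pose S := \sum_(I in B) y I; pose N := (Num.truncn S).+1.
apply: (@sub_finite_set _ _
  ((fun f : {ffun 'I_k.+1 -> 'I_N.+1} => \row_i (f i)%:Z) @` setT)); last first.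
  by apply: finite_image; exact: finite_finset.
move=> q hq; have q0 i := lattice_points_gt0 i hP hq.
have qN (i : 'I_k.+1) : (absz (q 0%R i) < N.+1)%N.
  move: (hq); rewrite /lattice_points /= EP => -[v [hv]].
  move=> /(congr1 (fun z : 'rV[R]__ => z 0 i)); rewrite mxE summxE => E.
  have le : (q 0 i)%:~R <= S.
    rewrite E; apply: ler_sum => I IB; rewrite mxE; apply: ler_piMr; first exact/ltW/y0.
    by have /andP[] := simplex_ge0 i (hv _ IB).
  rewrite ltnS -(ler_nat R); apply: le_trans (ltW (truncnS_gt S)).
  by rewrite pmulrn gtz0_abs.
exists [ffun i => Ordinal (qN i)] => //.
by apply/rowP => i; rewrite mxE ffunE /= gtz0_abs.
Qed.

(* Main.v *)
Require Import Defs.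
From mathcomp Require Import all_boot all_order all_algebra.
From mathcomp Require Import all_classical all_reals.
From mathcomp Require Import complex zify ring.

(** Write F(p) for the descent polynomial of s^-1(p). Splitting a preimage at its
    maximum n gives F(p n) = sum over p = p1 p2 of F(p1) F(p2), up to the
    conventions for empty factors. For increasing p this is the recursion
    N(t) = t (x + N(t)) (1 + N(t)), which Lagrange inversion solves by the Narayana
    polynomials. For p = L d S t, where d exceeds all entries of L and S and the
    entries of t increase above d, it yields by induction
    F(L d S t) = sum over i + j = |t| - 1 of F(S t_1 ... t_i) F(L d t_1 ... t_j).

    A permutation is thus a binary tree: the increasing ones are leaves, and nodes
    are convolutions in the number of top entries appended. The intervals of leaves
    below the nodes of a binary tree form a binary building set, and a binary
    building set is always of this kind once nodes of weight 0 are allowed. A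
    nestohedron is integral iff its weights are integers; its lattice points are then
    the integer points whose sum over every interval of the tree is at least the
    total weight inside this interval, with equality for the root. Cutting such a
    point at the root is the same convolution, so fertility polynomials (when
    nonzero) and lattice point polynomials are the same polynomials. *)

Set Implicit Arguments.
Unset Strict Implicit.
Unset Printing Implicit Defensive.

Import Order.TTheory GRing.Theory Num.Theory.
Local Open Scope ring_scope.

(** * Narayana polynomials and Lagrange inversion *)

Section Convolution.
Variable A : comNzRingType.
Implicit Types f g h : nat -> A.

Definition conv f g (n : nat) : A := \sum_(i < n.+1) f i * g (n - i)%N.

(** On generating functions this is multiplication by the variable. *)
Definition shift_seq f (n : nat) : A := if n is m.+1 then f m else 0.

Lemma eq_conv f f' g g' n : (forall i, (i <= n)%N -> f i = f' i) ->
  (forall i, (i <= n)%N -> g i = g' i) -> conv f g n = conv f' g' n.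
Proof.
move=> ff' gg'; apply: eq_bigr => i _.
by rewrite ff' ?gg' ?leq_subr // -ltnS.
Qed.

Lemma eq_shift_seq f f' n : (forall i, (i < n)%N -> f i = f' i) ->
  shift_seq f n = shift_seq f' n.
Proof. by case: n => //= n ->. Qed.

(** Truncated generating functions turn [conv] into a product of polynomials, so commutativity and
    associativity come from the polynomial ring. *)
Lemma coef_poly_conv N f g n : (n < N)%N ->
  ((\poly_(i < N) f i) * (\poly_(i < N) g i))`_n = conv f g n.
Proof.
move=> nN; rewrite coefM; apply: eq_bigr => i _; rewrite !coef_poly.
by rewrite (leq_ltn_trans (leq_subr _ _) nN) (leq_ltn_trans _ nN) // -ltnS.
Qed.

Lemma convC f g n : conv f g n = conv g f n.
Proof. by rewrite -!(@coef_poly_conv n.+1) // mulrC. Qed.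

Lemma convA f g h n : conv (conv f g) h n = conv f (conv g h) n.
Proof.
pose p (u : nat -> A) := \poly_(i < n.+1) u i.
transitivity ((p f * p g * p h)`_n).
  rewrite coefM; apply: eq_bigr => i _; rewrite coef_poly_conv //.
  by rewrite coef_poly ltnS leq_subr.
rewrite -mulrA coefM; apply: eq_bigr => i _; rewrite coef_poly ltn_ord.
by rewrite coef_poly_conv // ltnS leq_subr.
Qed.

Lemma conv_shiftl f g n : conv (shift_seq f) g n = shift_seq (conv f g) n.
Proof.
rewrite /conv big_ord_recl /= mul0r add0r; case: n => [|n] /=.
  by rewrite big_ord0.
by apply: eq_bigr => i _; rewrite subSS.
Qed.

Lemma conv_shiftr f g n : conv f (shift_seq g) n = shift_seq (conv f g) n.
Proof.
rewrite convC conv_shiftl; apply: eq_shift_seq => i _; exact: convC.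
Qed.

Lemma conv_iter_shift a b f g n :
  conv (iter a shift_seq f) (iter b shift_seq g) n = iter (a + b) shift_seq (conv f g) n.
Proof.
elim: a n => [|a IH] n /=.
  elim: b n => [|b IH] n //=.
  by rewrite conv_shiftr; apply: eq_shift_seq => i _; rewrite IH.
by rewrite conv_shiftl; apply: eq_shift_seq => i _; rewrite IH.
Qed.

Lemma convDl f f' g n :
  conv (fun i => f i + f' i) g n = conv f g n + conv f' g n.
Proof. by rewrite /conv -big_split; apply: eq_bigr => i _; rewrite mulrDl. Qed.

Lemma conv_suml (I : finType) (c : I -> A) (f : I -> nat -> A) g n :
  conv (fun i => \sum_j c j * f j i) g n = \sum_j c j * conv (f j) g n.
Proof.
rewrite /conv; under eq_bigr do rewrite mulr_suml.
rewrite exchange_big; apply: eq_bigr => j _; rewrite mulr_sumr.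
by apply: eq_bigr => i _; rewrite mulrA.
Qed.

End Convolution.

(** * Lagrange inversion for K(t) = t (x + K(t)) (1 + K(t)) *)

Section Lagrange.
Variable A : idomainType.
Hypothesis char0 : forall n, (n.+1%:R : A) != 0.
Variables (x : A) (K : nat -> A).
Hypothesis K0 : K 0%N = 0.
Hypothesis KS : forall n,
  K n.+1 = conv (fun i => x *+ (i == 0)%N + K i) (fun i => (i == 0)%N%:R + K i) n.

Let phi : {poly A} := x%:P + (1 + x)%:P * 'X + 'X^2.

(** Below degree [D] the functional equation reads k = X phi(k); it is multiplied by k^j. *)
Lemma power_coef_rec D j n : (n.+1 < D)%N -> let k := \poly_(i < D) K i in
  (k ^+ j.+1)`_n.+1 =
  x * (k ^+ j)`_n + (1 + x) * (k ^+ j.+1)`_n + (k ^+ j.+2)`_n.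
Proof.
move=> nD k.
have kE i : (i < D)%N -> k`_i = ('X * ((x%:P + k) * (1 + k)))`_i.
  case: i => [|i] iD; first by rewrite coefXM coef_poly iD K0.
  rewrite coefXM coef_poly iD /= KS coefM; apply: eq_bigr => -[l /= li] _.
  rewrite !coefD coefC coef1 !coef_poly.
  have lD : (l < D)%N by lia.
  have lD' : (i - l < D)%N by lia.
  by rewrite lD lD'; congr (_ * _); congr (_ + _); case: (l == 0%N).
have -> : (k ^+ j.+1)`_n.+1 = (k ^+ j * ('X * ((x%:P + k) * (1 + k))))`_n.+1.
  rewrite exprSr !coefM; apply: eq_bigr => i _; rewrite kE //.
  by rewrite (leq_ltn_trans (leq_subr _ _)).
have -> : k ^+ j * ('X * ((x%:P + k) * (1 + k))) =
    'X * (x%:P * k ^+ j + (1 + x)%:P * k ^+ j.+1 + k ^+ j.+2).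
  by rewrite polyCD !exprS; ring.
by rewrite coefXM /= !coefD !coefCM.
Qed.

Lemma power_coef_small D j n : (n < D)%N -> (n < j)%N ->
  ((\poly_(i < D) K i) ^+ j)`_n = 0.
Proof.
elim: n j => [|n IH] [|j] // nD nj.
  by rewrite exprS coef0M coef_poly nD K0 mul0r.
rewrite power_coef_rec // !IH ?(ltnW nD) //; try lia.
by rewrite !mulr0 !addr0.
Qed.

(* The coefficient of [X^m] in [phi * ('X * psi') = N ('X * phi') * psi],
   where [psi = phi ^+ N]. *)
Lemma phi_power_coef N m : let psi := phi ^+ N in
  x * (m%:R * psi`_m) + (1 + x) * ((m%:R - 1) * ('X * psi)`_m)
    + (m%:R - 2) * ('X^2 * psi)`_m =
  N%:R * ((1 + x) * ('X * psi)`_m + 2 * ('X^2 * psi)`_m).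
Proof.
move=> psi.
have E : phi * ('X * psi^`()) =
    N%:R%:P * ((1 + x)%:P * ('X * psi) + 2%:P * ('X^2 * psi)).
  rewrite !polyC_natr /psi deriv_exp -mulr_natl.
  have -> : phi^`() = (1 + x)%:P + 2 * 'X.
    rewrite /phi !derivD derivC add0r derivM derivC derivX derivXn mul0r add0r.
    by rewrite mulr1 expr1 mulr_natl.
  case: N psi => [|N] psi /=; first by rewrite !mul0r !mulr0.
  by rewrite -/psi /psi exprS; ring.
move/(congr1 (fun p : {poly A} => p`_m)): E.
rewrite coefCM coefD !coefCM => <-.
have -> : phi * ('X * psi^`()) = x%:P * ('X * psi^`())
    + (1 + x)%:P * ('X * ('X * psi^`())) + 'X * ('X * ('X * psi^`())).
  by rewrite /phi expr2 !mulrDl -!mulrA.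
have -> : 'X^2 * psi = 'X * ('X * psi) by rewrite expr2 mulrA.
rewrite !coefD !coefCM !coefXM.
case: m => [|[|m]] /=.
- by rewrite !mul0r !mulr0.
- by rewrite coef_deriv mulr1n subrr !(mul0r, mulr0, addr0) mul1r.
- by rewrite !coef_deriv; case: m => [|m] /=; ring.
Qed.

(** All powers are treated at once, by induction on j + m, because the recursion for k^(j+1)
    involves k^j and k^(j+2). *)
Lemma lagrange_power D j m : (j + m < D)%N ->
  (j + m)%:R * ((\poly_(i < D) K i) ^+ j)`_(j + m) =
  j%:R * (phi ^+ (j + m))`_m.
Proof.
move En : (j + m)%N => n; elim: n => [|n IH] in j m En *; move=> nD.
  by move/eqP: En; rewrite addn_eq0 => /andP[/eqP-> _]; rewrite !mul0r.
case: j En => [|j] En.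
  by rewrite expr0 coef1 /= mulr0 mul0r.
case: En => En; set k := \poly_(i < D) K i; set psi := phi ^+ n.
have rec := @power_coef_rec D j n nD; rewrite -/k /= in rec.
have E0 := IH j m En (ltnW nD); rewrite -/k -/psi in E0.
(* [E1] and [E2] are the induction hypothesis for the powers j + 1 and j + 2, except where [m]
   cannot be lowered any further; there both sides vanish. *)
have E1 : n%:R * (k ^+ j.+1)`_n = j.+1%:R * ('X * psi)`_m.
  case: m En {E0} => [|m] En; last first.
    by rewrite coefXM /= (IH j.+1 m) ?(ltnW nD) // -En addnS.
  by rewrite coefXM power_coef_small ?(ltnW nD) ?mulr0 // -En addn0.
have E2 : n%:R * (k ^+ j.+2)`_n = j.+2%:R * ('X^2 * psi)`_m.
  rewrite coefXnM; case: m En {E0 E1} => [|[|m]] En /=.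
  - by rewrite power_coef_small ?(ltnW nD) ?mulr0 // -En addn0.
  - by rewrite power_coef_small ?(ltnW nD) ?mulr0 // -En addn1.
  - by rewrite (IH j.+2 m) ?(ltnW nD) ?subn2 // -En !addnS.
have S := phi_power_coef n m; rewrite -/psi /= in S.
have P : (phi ^+ n.+1)`_m = x * psi`_m + (1 + x) * ('X * psi)`_m + ('X^2 * psi)`_m.
  rewrite exprS -/psi {1}/phi [(_ + _) * psi]mulrDl [(_ + _ * _) * psi]mulrDl.
  by rewrite -mulrA !coefD !coefCM.
(* [E0], [E1] and [E2] carry a factor [n], so they say nothing for n = 0; then j = m = 0 and both
   sides are computed. *)
case: n En nD IH @psi rec E0 E1 E2 S P => [|n] En nD IH psi rec E0 E1 E2 S P.
  move/eqP: En; rewrite addn_eq0 => /andP[/eqP ? /eqP ?]; subst j m.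
  rewrite rec !mul1r P !coefXM coefXnM /= !(mulr0, addr0) /psi !expr0 coef1 /=.
  by rewrite /k !power_coef_small ?(ltnW nD) // !(mulr0, addr0).
apply: (mulfI (char0 n)); rewrite rec P mulrCA !mulrDr.
rewrite [n.+1%:R * (x * _)]mulrCA E0 [n.+1%:R * ((1 + x) * _)]mulrCA E1 E2.
move: S; set a := psi`_m; set s1 := _`_m; set s2 := _`_m.
have En' : (n.+1%:R : A) = j%:R + m%:R by rewrite -natrD En.
rewrite -[n.+2%:R]natr1 -[j.+1%:R]natr1 -[j.+2%:R]natr1 -[j.+1%:R]natr1 En'.
(* After multiplication by n + 1, the difference of the two sides is the negative of the difference
   in [S]. *)
move/eqP; rewrite -subr_eq0 => /eqP S; apply/eqP; rewrite -subr_eq0.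
by apply/eqP; rewrite -[RHS]oppr0 -[in RHS]S; ring.
Qed.

Lemma lagrange n : n.+1%:R * K n.+1 = (phi ^+ n.+1)`_n.
Proof.
have := @lagrange_power n.+2 1 n (leqnn _).
by rewrite expr1 coef_poly add1n ltnSn mul1r.
Qed.

End Lagrange.

Lemma coef_exp_addXC (A : comNzRingType) (c : A) (n i : nat) :
  (('X + c%:P) ^+ n)`_i = c ^+ (n - i) *+ 'C(n, i).
Proof.
have -> : ('X + c%:P) ^+ n = \poly_(j < n.+1) (c ^+ (n - j) *+ 'C(n, j)).
  rewrite addrC exprDn poly_def; apply: eq_bigr => j _.
  by rewrite -polyC_exp mul_polyC scalerMnl.
by rewrite coef_poly; case: ltnP => // ni; rewrite bin_small.
Qed.

(** Here phi factors as (X + x) (X + 1), so (n + 1) K_(n+1) is the coefficient of X^n in (X +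
    x)^(n+1) (X + 1)^(n+1), a sum of products of two binomial coefficients. *)
Lemma narayana_unique (R : realType) (K : nat -> {poly R}) : K 0%N = 0 ->
  (forall n, K n.+1 = conv (fun i => 'X *+ (i == 0)%N + K i)
                           (fun i => (i == 0)%N%:R + K i) n) ->
  forall n, K n.+1 = narayana R n.+1.
Proof.
move=> K0 KS n.
have char0 m : (m.+1%:R : {poly R}) != 0.
  by rewrite -polyC_natr polyC_eq0 pnatr_eq0.
apply: (mulfI (char0 n)); rewrite (lagrange char0 K0 KS).
have -> : ('X : {poly R})%:P + (1 + 'X)%:P * 'X + 'X^2 =
    ('X + 'X%:P) * ('X + 1%:P) :> {poly {poly R}}.
  by rewrite polyCD; ring.
rewrite exprMn coefM /narayana -polyC_natr mul_polyC scaler_sumr.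
rewrite big_add1 /= big_mkord (reindex_inj rev_ord_inj) /=.
apply: eq_bigr => i _; rewrite subSS.
have le : (i <= n)%N by rewrite -ltnS.
have Ei : (n.+1 - (n - i) = i.+1)%N by rewrite subSn ?leq_subr // subKn.
have Eb : 'C(n.+1, n - i) = 'C(n.+1, i.+1) by rewrite -Ei bin_sub // leqW ?leq_subr.
rewrite !coef_exp_addXC expr1n subKn // Ei Eb scalerA mulrA mulrA mulfV ?pnatr_eq0 //.
by rewrite mul1r mulr_natr -mulrnA -natrM scaler_nat.
Qed.

(** * The recursion for fertility polynomials *)

Lemma des_cons (x y : nat) (s : seq nat) :
  des [:: x, y & s] = ((y < x) + des (y :: s))%N.
Proof.
rewrite /des /= -[1%N]/(1 + 0)%N iotaDl count_map.
by congr addn; apply: eq_count.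
Qed.

(** The maximum ends no descent, and starts one exactly when an entry follows it. *)
Lemma des_cat_max (L S : seq nat) (n : nat) :
  all (fun x => x < n)%N L -> all (fun x => x < n)%N S ->
  des (L ++ n :: S) = (des L + des S + (S != [::]))%N.
Proof.
move=> + hS; elim: L => [_|x [|y L] IH] /=.
- case: S hS => [|y S] //= /andP[yn _].
  by rewrite des_cons yn addn1.
- by rewrite andbT => xn; have := IH isT; rewrite des_cons /= ltnNge (ltnW xn) => ->.
- by case/andP=> _ /IH; rewrite !des_cons /= => ->; rewrite !addnA.
Qed.

Lemma stack_sort_rcons_max (s : seq nat) : s != [::] ->
  exists t, stack_sort s = rcons t (\max_(x <- s) x)%N.
Proof.
case: s => // x s _; rewrite /stack_sort /= catA cats1.
by eexists.
Qed.

Lemma mem_preimage (p s : seq nat) :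
  (s \in [seq s <- permutations p | stack_sort s == p]) = (stack_sort s == p).
Proof.
rewrite mem_filter mem_permutations.
by case: eqP => //= <-; rewrite perm_sym perm_stack_sort.
Qed.

Lemma preimage_uniq (p : seq nat) :
  uniq [seq s <- permutations p | stack_sort s == p].
Proof. exact: filter_uniq (permutations_uniq p). Qed.

Lemma cat_max_inj (p : seq nat) (n : nat) : all (fun x => x < n)%N p ->
  forall L T L' T', perm_eq (L ++ T) p -> perm_eq (L' ++ T') p ->
  L ++ n :: T = L' ++ n :: T' -> L = L' /\ T = T'.
Proof.
move=> hp L T L' T' h h' E.
have hn A B : perm_eq (A ++ B) p -> index n (A ++ n :: B) = size A.
  move=> hAB; rewrite index_cat; case: ifP => [nA|_]; last by rewrite /= eqxx addn0.
  have : n \in p by rewrite -(perm_mem hAB) mem_cat nA.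
  by move/(allP hp); rewrite ltnn.
have sz : size L = size L' by rewrite -(hn _ _ h) E hn.
by move/eqP: E; rewrite eqseq_cat // eqseq_cons => /and3P[/eqP-> _ /eqP->].
Qed.

(** A preimage of p n has the form L n T with s(L) s(T) = p, so it amounts to a cut of p and a
    preimage of each half. *)
Lemma preimage_rcons (p : seq nat) (n : nat) : all (fun x => x < n)%N p ->
  perm_eq [seq s <- permutations (rcons p n) | stack_sort s == rcons p n]
    [seq q.1 ++ n :: q.2 | i <- iota 0 (size p).+1,
       q <- [seq (L, T) |
              L <- [seq s <- permutations (take i p) | stack_sort s == take i p],
              T <- [seq s <- permutations (drop i p) | stack_sort s == drop i p]]].
Proof.
move=> hp; apply: uniq_perm; first exact: preimage_uniq.
  apply: allpairs_uniq_dep; first exact: iota_uniq.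
    move=> i _; apply: allpairs_uniq; try exact: preimage_uniq.
    by move=> [? ?] [? ?].
  move=> u v hu hv.
  have [i [q [hi /allpairsP[[L T] /= [hL hT Eq]] Eu]]] := elimT allpairsPdep hu.
  have [i' [q' [hi' /allpairsP[[L' T'] /= [hL' hT' Eq']] Ev]]] := elimT allpairsPdep hv.
  subst u v q q'; rewrite {hu hv} /=; move: hL hT hL' hT'; rewrite !mem_filter !mem_permutations.
  move=> /andP[_ hL] /andP[_ hS] /andP[_ hL'] /andP[_ hS'].
  have h := perm_cat hL hS; have h' := perm_cat hL' hS'.
  rewrite !cat_take_drop in h h'.
  move=> /(cat_max_inj hp h h')[EL ES]; subst L' T'.
  have : size (take i p) = size (take i' p) by rewrite -(perm_size hL) (perm_size hL').
  move: hi hi'; rewrite !mem_iota !add0n !ltnS /= => hi hi'.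
  by rewrite !size_takel // => ->.
move=> s; rewrite mem_preimage; apply/eqP/allpairsPdep => [E|].
  have hs : perm_eq s (rcons p n) by rewrite -E perm_sym perm_stack_sort.
  have ns : n \in s by rewrite (perm_mem hs) mem_rcons mem_head.
  case/splitPr: ns E hs => L T E hs.
  have hLS : perm_eq (L ++ T) p.
    rewrite -(perm_cons n); apply: perm_trans (perm_trans hs _).
      by rewrite -[_ :: T]cat1s perm_sym perm_catCA.
    by rewrite perm_rcons.
  have lt : all (fun x => x < n)%N (L ++ T) by rewrite (perm_all _ hLS).
  move: lt; rewrite all_cat => /andP[ltL ltS].
  move: E; rewrite stack_sort_cat // catA cats1 => /rcons_inj[E].
  have sL : size (stack_sort L) = size L by rewrite (perm_size (perm_stack_sort L)).
  exists (size L), (L, T); split=> //.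
    by rewrite mem_iota add0n ltnS -(perm_size hLS) size_cat leq_addr.
  apply/allpairsP; exists (L, T); rewrite !mem_preimage.
  by rewrite -E take_cat drop_cat sL ltnn subnn take0 cats0 drop0 !eqxx.
move=> [i [_ [hi /allpairsP[[L T] /= [hL hS ->]] -> /=]]].
move: hL hS; rewrite !mem_preimage => /eqP EL /eqP ES.
have lt A B : stack_sort A = B -> all (fun x => x < n)%N B -> all (fun x => x < n)%N A.
  by move=> <-; rewrite (perm_all _ (perm_stack_sort A)).
have : all (fun x => x < n)%N (take i p ++ drop i p) by rewrite cat_take_drop.
rewrite all_cat => /andP[h1 h2].
rewrite stack_sort_cat ?EL ?ES ?(lt _ _ EL) ?(lt _ _ ES) //.
by rewrite catA cat_take_drop cats1.
Qed.

Definition fertility_poly (R : realType) (p : seq nat) : {poly R} :=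
  \sum_(s <- permutations p | stack_sort s == p) 'X^((des s).+1).

(** A nonempty word T to the right of the maximum contributes des(T) + 1 descents, including the one
    from the maximum; an empty one contributes none, hence the value 1 instead of x. *)
Definition right_fertility_poly (R : realType) (p : seq nat) : {poly R} :=
  if p == [::] then 1 else fertility_poly R p.

Lemma preimage_polyE (R : realType) (p : seq nat) : is_permutation p ->
  preimage_poly R p = fertility_poly R p.
Proof.
move=> pp; rewrite /preimage_poly /fertility_poly -[RHS]big_filter.
rewrite [RHS]fsbig_seq ?preimage_uniq //; apply: eq_fsbigl.
apply/funext => s; apply/propext; rewrite /= mem_preimage; split.
  by case=> _ ->.
move/eqP=> E; split=> //; have h := perm_stack_sort s.
move: pp; rewrite -E /is_permutation (perm_uniq h).
by rewrite (perm_all _ h).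
Qed.

Lemma fertility_poly_nil (R : realType) : fertility_poly R [::] = 'X.
Proof. by rewrite /fertility_poly /= big_cons big_nil addr0 expr1. Qed.

Lemma fertility_poly_rcons (R : realType) (p : seq nat) (n : nat) :
  all (fun x => x < n)%N p ->
  fertility_poly R (rcons p n) =
  \sum_(i < (size p).+1)
     fertility_poly R (take i p) * right_fertility_poly R (drop i p).
Proof.
move=> hp; rewrite {1}/fertility_poly -big_filter (perm_big _ (preimage_rcons hp)).
rewrite big_allpairs_dep -[X in iota 0 X]subn0 -/(index_iota 0 (size p).+1).
rewrite big_mkord; apply: eq_bigr => i _; rewrite big_allpairs mulr_suml.
rewrite -[in RHS]big_filter; apply: eq_big_seq => L; rewrite mem_preimage => /eqP EL.
have : all (fun x => x < n)%N (take i p ++ drop i p) by rewrite cat_take_drop.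
rewrite all_cat => /andP[h1 h2].
rewrite (eq_big_seq (fun T => 'X^((des L).+1) *
   (if drop i p == [::] then 1 else 'X^((des T).+1)))).
  rewrite -mulr_sumr /right_fertility_poly; congr (_ * _).
  case: eqP => [->|_]; last by rewrite /fertility_poly -[in RHS]big_filter.
  by rewrite /= big_cons big_nil addr0.
move=> T; rewrite mem_preimage => /eqP ES /=.
rewrite des_cat_max; last 2 first.
- by rewrite -(perm_all _ (perm_stack_sort L)) EL.
- by rewrite -(perm_all _ (perm_stack_sort T)) ES.
have -> : (drop i p == [::]) = (T == [::]).
  by rewrite -!size_eq0 -ES (perm_size (perm_stack_sort T)).
case: (T =P [::]) => [->|_] /=; first by rewrite mulr1 !addn0.
by rewrite -exprD addn1 addnS addSn.
Qed.

(** Every nonempty stack-sorted word ends with its maximum. *)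
Lemma fertility_poly_eq0 (R : realType) (p : seq nat) (n x : nat) :
  x \in p -> (n < x)%N -> fertility_poly R (rcons p n) = 0.
Proof.
move=> xp nx; rewrite /fertility_poly big1_seq // => s /andP[/eqP E _].
have hs : perm_eq s (rcons p n) by rewrite -E perm_sym perm_stack_sort.
have s0 : s != [::].
  by rewrite -size_eq0 (perm_size hs) size_rcons.
have [t] := stack_sort_rcons_max s0; rewrite E => /rcons_inj[_ En].
have xs : x \in s by rewrite (perm_mem hs) mem_rcons inE xp orbT.
have : (x <= \max_(y <- s) y)%N by rewrite (@leq_bigmax_seq _ s xpredT id).
by rewrite -En leqNgt nx.
Qed.

(** * The hook decomposition *)

Section Splits.
Variables (A : comNzRingType) (f g : seq nat -> A).

(** The two factors are parameters so that a fixed prefix can be absorbed into [f]. *)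
Definition split_sum (p : seq nat) : A :=
  \sum_(i < (size p).+1) f (take i p) * g (drop i p).

Lemma split_sum_cat (p q : seq nat) : split_sum (p ++ q) =
  \sum_(i < size p) f (take i p) * g (drop i p ++ q) +
  \sum_(i < (size q).+1) f (p ++ take i q) * g (drop i q).
Proof.
rewrite /split_sum size_cat -addnS big_split_ord /=; congr (_ + _).
  apply: eq_bigr => -[i /= ip] _.
  by rewrite takel_cat ?drop_cat ?ip // ltnW.
apply: eq_bigr => i _.
by rewrite take_cat drop_cat !ltnNge !leq_addr /= addKn.
Qed.

End Splits.

Lemma conv_recl (A : comNzRingType) (f g : nat -> A) n :
  conv f g n = f 0%N * g n + shift_seq (conv (fun i => f i.+1) g) n.
Proof.
rewrite /conv big_ord_recl subn0; congr (_ + _).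
by case: n => [|n]; rewrite ?big_ord0 //=.
Qed.

Lemma shiftD (A : comNzRingType) (f g : nat -> A) n :
  shift_seq (fun i => f i + g i) n = shift_seq f n + shift_seq g n.
Proof. by case: n => //=; rewrite addr0. Qed.

Lemma shift_sum (A : comNzRingType) (I : finType) (c : I -> A) (f : I -> nat -> A) n :
  shift_seq (fun i => \sum_j c j * f j i) n = \sum_j c j * shift_seq (f j) n.
Proof. by case: n => //=; rewrite big1 // => i _; rewrite mulr0. Qed.

Lemma sorted_rcons_all (t : seq nat) (x : nat) :
  sorted ltn (rcons t x) -> all (fun y => y < x)%N t.
Proof. by rewrite (sorted_pairwise ltn_trans) pairwise_rcons => /andP[]. Qed.

Section Fertility.
Variable R : realType.
Local Notation F := (fertility_poly R).
Local Notation G := (right_fertility_poly R).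

(** Cutting an increasing word gives increasing words, so by induction only the length matters. *)
Lemma fertility_poly_sorted_eq (t u : seq nat) :
  sorted ltn t -> sorted ltn u -> size t = size u -> F t = F u.
Proof.
move En : (size t) => n; elim/ltn_ind: n => n IH in t u En *.
case/lastP: t En => [|t x] En; case/lastP: u => [|u y] st su; rewrite ?size_rcons.
- by [].
- by move=> h; rewrite /= in En; move: h; rewrite -En.
- by move=> h; move: En; rewrite size_rcons h.
rewrite size_rcons in En; rewrite -{}En in IH * => -[Es].
rewrite !fertility_poly_rcons ?sorted_rcons_all // -Es.
have st' : sorted ltn t by move: st; rewrite -cats1 => /cat_sorted2[].
have su' : sorted ltn u by move: su; rewrite -cats1 => /cat_sorted2[].
apply: eq_bigr => i _; have ile : (i <= size t)%N by rewrite -ltnS.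
congr (_ * _).
  by apply: (IH i); rewrite ?ltn_ord ?take_sorted ?size_takel -?Es.
rewrite /right_fertility_poly -!size_eq0 !size_drop -Es.
case: ifP => // _; apply: (IH (size t - i)%N); rewrite ?drop_sorted ?size_drop -?Es //.
by rewrite ltnS leq_subr.
Qed.

Lemma fertility_poly_sorted (t : seq nat) : sorted ltn t ->
  F t = if size t == 0%N then 'X else narayana R (size t).
Proof.
case: t => [|x t] st; first by rewrite fertility_poly_nil.
(* With K 0 = 0, the values x and 1 of the empty word on the left and on the right become the
   constants in (x + K) (1 + K). *)
pose K n := if n is m.+1 then F (iota 0 m.+1) else 0.
have -> : F (x :: t) = K (size t).+1.
  by apply: fertility_poly_sorted_eq; rewrite ?iota_ltn_sorted ?size_iota.
rewrite /= -[RHS](@narayana_unique R K) // => n; rewrite /K.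
rewrite -addn1 iotaD add0n cats1 fertility_poly_rcons; last first.
  by apply/allP => i; rewrite mem_iota.
rewrite size_iota; apply: eq_bigr => -[i /= ile] _; rewrite ltnS in ile; congr (_ * _).
  rewrite take_iota (minn_idPl ile); case: i {ile} => [|i] /=.
    by rewrite fertility_poly_nil addr0.
  by rewrite mulr0n add0r.
rewrite drop_iota add0n /right_fertility_poly -size_eq0 size_iota subn_eq0.
case: (leqP n i) => [h|h].
  have -> : (n - i = 0)%N by lia.
  by rewrite addr0.
have -> : (n - i = (n - i).-1.+1)%N by lia.
rewrite add0r; apply: fertility_poly_sorted_eq; rewrite ?iota_ltn_sorted //.
  exact: (iota_ltn_sorted 0 (n - i).-1.+1).
by rewrite /= !size_iota.
Qed.

Let g (n : nat) : {poly R} := if n == 0%N then 1 else narayana R n.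

Lemma right_fertility_poly_sorted (t : seq nat) : sorted ltn t -> G t = g (size t).
Proof.
move=> st; rewrite /right_fertility_poly -size_eq0 fertility_poly_sorted // /g.
by case: (size t).
Qed.

Lemma fertility_poly_cat_sorted (p t : seq nat) (j : nat) :
  sorted ltn t -> (forall x y, x \in p -> y \in t -> x < y)%N -> (j < size t)%N ->
  F (p ++ take j.+1 t) = split_sum F G (p ++ take j t).
Proof.
move=> st pt jt; rewrite (take_nth 0%N jt) -rcons_cat fertility_poly_rcons //.
rewrite all_cat; apply/andP; split.
  by apply/allP => x xp; apply: pt; rewrite ?mem_nth.
by apply: sorted_rcons_all; rewrite -take_nth // take_sorted.
Qed.

(* Cf. Defant's decomposition lemma: the sum is over the hooks from [d] to the
   entries of [t]; the hook to the entry of index [i] shelters [S ++ take i t]. *)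
Lemma fertility_poly_hook (L S t : seq nat) (d : nat) :
  all (fun x => x < d)%N L -> all (fun x => x < d)%N S -> S != [::] ->
  sorted ltn (d :: t) ->
  F (rcons L d ++ S ++ t) =
  shift_seq (conv (fun j => F (rcons L d ++ take j t)) (fun i => F (S ++ take i t)))
    (size t).
Proof.
move=> + hS S0; move En : (size t) => n; elim/ltn_ind: n => n IH in L t En *.
case/lastP: t En => [|t x] En hL sdt.
  (* For empty [t] the left side is 0, as the word ends with an entry of [S], below [d]. *)
  rewrite -En cats0 /=; case/lastP: S S0 hS {IH} => // S y _.
  rewrite all_rcons => /andP[yd _]; rewrite -rcons_cat.
  by apply: (@fertility_poly_eq0 _ _ _ d) => //; rewrite mem_cat mem_rcons mem_head.
rewrite size_rcons in En; rewrite -{n}En in IH *.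
have sdt' : sorted ltn (d :: t).
  by move: sdt; rewrite -rcons_cons -cats1 => /cat_sorted2[].
have st := path_sorted sdt; have st' := path_sorted sdt'.
have dx : (d < x)%N by have := sorted_rcons_all (sdt : sorted ltn (rcons (d :: t) x)); case/andP.
have pt p : all (fun x => x < d)%N p ->
    forall a b, a \in p -> b \in rcons t x -> (a < b)%N.
  move=> hp a b /(allP hp) ad bt; apply: ltn_trans ad _.
  by move: (order_path_min ltn_trans sdt) => /allP; apply.
have ptL L' : all (fun x => x < d)%N L' ->
    forall a b, a \in rcons L' d -> b \in rcons t x -> (a < b)%N.
  move=> hL' a b; rewrite mem_rcons inE => /orP[/eqP->|]; last exact: pt.
  by move: (order_path_min ltn_trans sdt) => /allP; apply.
have take_t j : (j <= size t)%N -> take j (rcons t x) = take j t.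
  by move=> jt; rewrite -cats1 takel_cat.
set a := fun j : nat => F (rcons L d ++ take j (rcons t x)).
set b := fun i : nat => F (S ++ take i (rcons t x)).
pose ai (i : 'I_(size L).+1) (j : nat) := F (rcons (drop i L) d ++ take j t).
have drop_rcons' (i : 'I_(size L).+1) : drop i (rcons L d) = rcons (drop i L) d.
  by rewrite drop_rcons // -ltnS.
have take_rcons' (i : 'I_(size L).+1) : take i (rcons L d) = take i L.
  by rewrite -cats1 takel_cat // -ltnS.
have hLd (i : 'I_(size L).+1) : all (fun x => x < d)%N (drop i L).
  by apply/allP => y /mem_drop; apply: (allP hL).
(* Recursion for the first factor of the convolution: the cut lies in [L], up to just before [d], or
   after [d]. *)
have aS j : (j <= size t)%N ->
    a j.+1 = \sum_(i < (size L).+1) F (take i L) * ai i j + conv a g j.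
  move=> jt; rewrite /a (fertility_poly_cat_sorted st (ptL _ hL)) ?size_rcons //.
  rewrite split_sum_cat size_rcons; congr (_ + _).
    apply: eq_bigr => i _; rewrite take_rcons' drop_rcons' /ai take_t //.
    by rewrite /right_fertility_poly; case: (drop i L).
  rewrite take_t // size_takel //; apply: eq_bigr => i _.
  have ij : (i <= j)%N by rewrite -ltnS.
  rewrite take_takel // take_t ?(leq_trans ij) // right_fertility_poly_sorted.
    by rewrite size_drop size_takel.
  by rewrite drop_sorted // take_sorted.
(* The cuts of L d S t lie before [d], right after [d], or after [S]. A cut inside [S] leaves a left
   part that contains [d] and ends below it, so it contributes 0. *)
have FS : F (rcons L d ++ S ++ rcons t x) =
    \sum_(i < (size L).+1) F (take i L) * F (rcons (drop i L) d ++ S ++ t)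
    + F (rcons L d) * F (S ++ t)
    + \sum_(i < (size t).+1) F (rcons L d ++ S ++ take i t) * g (size t - i)%N.
  have -> : rcons L d ++ S ++ rcons t x = rcons (rcons L d ++ S ++ t) x.
    by rewrite !rcons_cat.
  rewrite fertility_poly_rcons; last first.
    rewrite !all_cat all_rcons dx /=.
    have lt p : all (fun x => x < d)%N p -> all (fun y => y < x)%N p.
      by move=> hp; apply: sub_all hp => y /= yd; apply: ltn_trans dx.
    by rewrite (lt _ hL) (lt _ hS) (sorted_rcons_all st).
  rewrite -/(split_sum F G _) split_sum_cat size_rcons -addrA; congr (_ + _).
    apply: eq_bigr => i _; rewrite take_rcons' drop_rcons'.
    by rewrite /right_fertility_poly; case: (drop i L).
  have big0 i : (0 < i <= size S)%N -> F (rcons L d ++ take i S) = 0.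
    move=> /andP[i0 iS]; case/lastP E : (take i S) => [|S' y].
      by have := congr1 size E; rewrite size_takel // => i0'; move: i0; rewrite i0'.
    rewrite -rcons_cat; apply: (@fertility_poly_eq0 _ _ _ d).
      by rewrite mem_cat mem_rcons mem_head.
    have : y \in take i S by rewrite E mem_rcons mem_head.
    by move/mem_take/(allP hS).
  rewrite -/(split_sum (fun p => F (rcons L d ++ p)) G _) split_sum_cat.
  congr (_ + _); last first.
    apply: eq_bigr => i _; rewrite right_fertility_poly_sorted ?drop_sorted //.
    by rewrite size_drop.
  have Spos : (0 < size S)%N by rewrite lt0n size_eq0.
  rewrite (bigD1 (Ordinal Spos)) //= take0 drop0 cats0 big1 ?addr0.
    by rewrite /right_fertility_poly; case: (S) S0.
  by move=> i i0; rewrite big0 ?mul0r // (ltnW (ltn_ord i)) lt0n andbT.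
have bt i : (i <= size t)%N -> b i = F (S ++ take i t) by move=> it; rewrite /b take_t.
rewrite FS /= conv_recl [_ + F (rcons L d) * _]addrC -addrA; congr (_ + _).
  by rewrite /a /b take0 cats0 take_t // take_size.
(* Regrouping (a * g) * b as (a * b) * g makes the induction hypothesis applicable: to suffixes of
   [L] in the first sum, to prefixes of [t] in the second. *)
have -> : shift_seq (conv (fun i => a i.+1) b) (size t) =
    shift_seq (fun n => \sum_(i < (size L).+1) F (take i L) * conv (ai i) b n
                    + conv (conv a b) g n) (size t).
  apply: eq_shift_seq => i it; rewrite (@eq_conv _ _ (fun j => \sum_(k < (size L).+1)
    F (take k L) * ai k j + conv a g j) b b) //; last first.
    by move=> j ji; rewrite aS // (leq_trans ji) // ltnW.
  rewrite convDl conv_suml; congr (_ + _).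
  by rewrite !convA; apply: eq_conv => // j _; rewrite convC.
rewrite shiftD shift_sum; congr (_ + _).
  apply: eq_bigr => i _; congr (_ * _); rewrite (IH (size t)) //.
  apply: eq_shift_seq => j jt; apply: eq_conv => k kj //.
  by rewrite bt //; lia.
rewrite -conv_shiftl; apply: eq_bigr => i _; congr (_ * _).
have it : (i <= size t)%N by rewrite -ltnS.
rewrite (IH i) ?size_takel //; last by rewrite -[d :: _]/(take i.+1 (d :: t)) take_sorted.
apply: eq_shift_seq => j ji; apply: eq_conv => k kj; rewrite /a /b take_takel ?take_t //; lia.
Qed.

End Fertility.

(** * Permutations and binary trees *)

(* A binary tree whose leaves [0, ..., k] are the coordinates of R^(k+1): a node
   stands for the simplex on the interval of its leaves, dilated by its weight
   ([y.+1] at [Leaf y]). *)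
Inductive tree := Leaf of nat | Node of nat & tree & tree.

Section TreePoly.
Variable R : realType.
Local Notation F := (fertility_poly R).

(** The argument [c] counts the top entries appended to a permutation; for lattice points it is the
    excess of the coordinate sum over [weight T]. *)
Fixpoint tree_poly (T : tree) (c : nat) : {poly R} :=
  match T with
  | Leaf y => narayana R (y.+1 + c)
  | Node w l r => conv (tree_poly l) (tree_poly r) (w + c)
  end.

Definition grow_root (T : tree) : tree :=
  match T with Leaf y => Leaf y.+1 | Node w l r => Node w.+1 l r end.

Lemma tree_poly_grow_root T c : tree_poly (grow_root T) c = tree_poly T c.+1.
Proof. by case: T => [y|w l r] /=; rewrite addSnnS. Qed.

(** Induction on the length, splitting [p] at its maximum [m]. Entries after [m] make it a hook and
    give a node; otherwise [m] is a top entry appended to [L]. The offset [o] is the number of top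
    entries that must be appended before the polynomial can be nonzero. *)
Lemma fertility_poly_tree (p : seq nat) : uniq p -> p != [::] ->
  exists (T : tree) (o : nat), forall t : seq nat, sorted ltn t ->
    (forall x y, x \in p -> y \in t -> (x < y)%N) ->
    F (p ++ t) = iter o (@shift_seq _) (tree_poly T) (size t).
Proof.
move En : (size p) => n; elim/ltn_ind: n => n IH in p En * => up p0.
have [x [q Ep]] : exists x q, p = x :: q by case: p p0 {En up} => // x q _; exists x, q.
have mp : (\max_(z <- p) z)%N \in p by rewrite Ep max_mem.
have le_m y : y \in p -> (y <= \max_(z <- p) z)%N.
  by move=> yp; rewrite (@leq_bigmax_seq _ p xpredT id).
move: mp le_m; set m := bigop.body _ _ _ => mp le_m {x q Ep p0}.
case/splitPr: mp En up le_m => L S En up le_m.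
have /andP[mLS uLS] : (m \notin L ++ S) && uniq (L ++ S).
  by move: up; rewrite -cat1s uniq_catCA.
have lt_m y : y \in L ++ S -> (y < m)%N.
  move=> yLS; rewrite ltn_neqAle le_m ?andbT; last first.
    by move: yLS; rewrite !mem_cat inE => /orP[->|->]; rewrite ?orbT.
  by apply: contraNneq mLS => <-.
have allL : all (fun y => y < m)%N L.
  by apply/allP => y yL; apply: lt_m; rewrite mem_cat yL.
have allS : all (fun y => y < m)%N S.
  by apply/allP => y yS; apply: lt_m; rewrite mem_cat yS orbT.
have sorted_m t : sorted ltn t -> (forall x y, x \in L ++ m :: S -> y \in t -> (x < y)%N) ->
    sorted ltn (m :: t).
  move=> st Lt; rewrite /= (path_sortedE ltn_trans) st andbT.
  by apply/allP => y yt; apply: Lt; rewrite ?mem_cat ?mem_head ?orbT.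
move: uLS; rewrite cat_uniq => /and3P[uL _ uS].
case: (S =P [::]) => [S0|/eqP S0].
  subst S; case: (L =P [::]) => [L0|/eqP L0].
    subst L; exists (Leaf 0), 0%N => t st Lt.
    by rewrite fertility_poly_sorted //; apply: sorted_m.
  have [|T [o HT]] := IH (size L) _ L erefl uL L0.
    by rewrite -En size_cat addn1.
  have {}HT t : sorted ltn t ->
      (forall x y, x \in L ++ [:: m] -> y \in t -> (x < y)%N) ->
      F ((L ++ [:: m]) ++ t) = iter o (@shift_seq _) (tree_poly T) (size t).+1.
    move=> st Lt; rewrite -catA HT //; first exact: sorted_m.
    move=> x y xL; rewrite inE => /orP[/eqP->|]; first exact: (allP allL).
    by apply: Lt; rewrite mem_cat xL.
  (* The top entry [m] cancels one shift, or raises the weight of the root if there is none. *)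
  case: o HT => [|o] HT; last by exists T, o.
  by exists (grow_root T), 0%N => t st Lt; rewrite HT //= tree_poly_grow_root.
have [|||T1 [o1 H1]] := IH (size (rcons L m)) _ (rcons L m) erefl.
- by rewrite -En size_rcons size_cat /= addnS ltnS -[ltnLHS]addn0 ltn_add2l lt0n size_eq0.
- by rewrite rcons_uniq uL andbT; apply: contra mLS; rewrite mem_cat => ->.
- by case: (L).
have [|T2 [o2 H2]] := IH (size S) _ S erefl uS S0.
  by rewrite -En size_cat /= addnS ltnS leq_addl.
exists (Node 0 T1 T2), (o1 + o2).+1 => t st Lt.
rewrite -catA cat_cons -cat_rcons fertility_poly_hook //; last exact: sorted_m.
rewrite iterS; apply: eq_shift_seq => i it.
rewrite -[tree_poly _]/(conv (tree_poly T1) (tree_poly T2)) -conv_iter_shift.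
apply: eq_conv => j ji; have jt : (j <= size t)%N by lia.
  rewrite H1 ?take_sorted ?size_takel // => x y xL /mem_take yt; apply: Lt => //.
  by move: xL; rewrite mem_rcons mem_cat !inE => /orP[->|->]; rewrite ?orbT.
rewrite H2 ?take_sorted ?size_takel // => x y xS /mem_take yt; apply: Lt => //.
by rewrite mem_cat inE xS !orbT.
Qed.

(** The lower bound [m] allows value ranges to be stacked: the word of the left subtree is placed
    above all values of the word of the right subtree. *)
Lemma tree_fertility_poly (T : tree) (m : nat) : exists (L : seq nat) (d : nat),
  [/\ uniq (rcons L d), all (leq m) (rcons L d), all (fun x => x < d)%N L
    & forall t, sorted ltn (d :: t) -> F (rcons L d ++ t) = tree_poly T (size t)].
Proof.
elim: T m => [y|w l IHl r IHr] m.
  have E : iota m y.+1 = rcons (iota m y) (m + y) by rewrite -addn1 iotaD cats1.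
  exists (iota m y), (m + y)%N; split; rewrite -?E ?iota_uniq //.
  - by apply/allP => i; rewrite mem_iota => /andP[].
  - by apply/allP => i; rewrite mem_iota => /andP[].
  move=> t; rewrite E => st; rewrite fertility_poly_sorted.
    by rewrite -E size_cat size_iota.
  rewrite cat_rcons (sorted_pairwise ltn_trans) pairwise_cat.
  rewrite -!(sorted_pairwise ltn_trans) iota_ltn_sorted st /= andbT.
  apply/allrelP => a b; rewrite mem_iota inE => /andP[_ ay] /orP[/eqP->//|bt].
  apply: ltn_trans ay _.
  by have /allP/(_ _ bt) := order_path_min ltn_trans st.
have [S [e [uS mS Se HS]]] := IHr m.
have [L [d [uL mL Ld HL]]] := IHl e.+1.
have Sd : all (fun x => x < d)%N (rcons S e).
  have ed : (e < d)%N by move/allP: mL => /(_ d); rewrite mem_rcons mem_head; apply.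
  by rewrite all_rcons ed; apply: sub_all Se => x /= xe; apply: ltn_trans xe ed.
(* Of the w + 1 top entries d + 1, ..., D, one is absorbed by the shift in the hook decomposition;
   [w] remain for the root. *)
set D := (d.+1 + w)%N.
have E : rcons (rcons L d ++ rcons S e ++ iota d.+1 w) D =
    rcons L d ++ rcons S e ++ iota d.+1 w.+1.
  by rewrite -[w.+1]addn1 iotaD cats1 !rcons_cat.
have memL x : x \in rcons L d -> (e < x <= d)%N.
  move=> xL; rewrite (allP mL) //=; move: xL; rewrite mem_rcons inE.
  by case/orP=> [/eqP->//|/(allP Ld)/ltnW].
have memS x : x \in rcons S e -> (m <= x <= e)%N.
  move=> xS; rewrite (allP mS) //=; move: xS; rewrite mem_rcons inE.
  by case/orP=> [/eqP->//|/(allP Se)/ltnW].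
have ed : (m <= e < d)%N.
  have := memL d; rewrite mem_rcons mem_head => /(_ isT).
  by have := memS e; rewrite mem_rcons mem_head => /(_ isT); lia.
exists (rcons L d ++ rcons S e ++ iota d.+1 w), D; split.
- rewrite E !cat_uniq uL uS iota_uniq -[iota _ _]/(iota _ w.+1) !andTb andbT; apply/andP; split.
    apply/hasPn => x; rewrite mem_cat mem_iota => xSi; apply/negP => /memL.
    by case/orP: xSi => [/memS|]; lia.
  apply/hasPn => x; rewrite mem_iota => xi; apply/negP => /memS; lia.
- rewrite E; apply/allP => x; rewrite !mem_cat mem_iota.
  by case/or3P=> [/memL|/memS|]; lia.
- apply/allP => x; rewrite !mem_cat mem_iota /D.
  by case/or3P=> [/memL|/memS|]; lia.
move=> t st; rewrite E -!catA.
have sdt : sorted ltn (d :: iota d.+1 w.+1 ++ t).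
  rewrite -cat_cons -[d :: iota d.+1 w.+1]/(iota d w.+2) (sorted_pairwise ltn_trans).
  rewrite pairwise_cat -!(sorted_pairwise ltn_trans) iota_ltn_sorted (path_sorted st) !andbT.
  apply/allrelP => a b; rewrite mem_iota => ai /(allP (order_path_min ltn_trans st)) /=.
  by rewrite /D; lia.
rewrite fertility_poly_hook //; last by case: (S).
rewrite size_cat size_iota addSn /=; apply: eq_conv => j jle.
  rewrite HL; last exact: (@take_sorted _ _ j.+1 _ sdt).
  by rewrite size_takel //= size_cat size_iota; lia.
rewrite HS; last first.
  rewrite /= (path_sortedE ltn_trans) take_sorted ?(path_sorted sdt) // andbT.
  apply/allP => x /mem_take /(allP (order_path_min ltn_trans sdt)) /=; lia.
by rewrite size_takel //= size_cat size_iota; lia.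
Qed.

End TreePoly.

(** * Points of a tree *)

Fixpoint leaves (T : tree) : nat :=
  match T with Leaf _ => 1 | Node _ l r => leaves l + leaves r end.

Fixpoint weight (T : tree) : nat :=
  match T with Leaf y => y.+1 | Node w l r => w + (weight l + weight r) end.

(** For lists of length [leaves T], the sum at a leaf is a single coordinate. *)
Fixpoint feasible (T : tree) (q : seq nat) : bool :=
  match T with
  | Leaf y => y < sumn q
  | Node _ l r =>
      [&& feasible l (take (leaves l) q), feasible r (drop (leaves l) q)
        & weight T <= sumn q]
  end%N.

Definition cat_points (f g : nat -> seq (seq nat)) (n : nat) : seq (seq nat) :=
  flatten [seq [seq p ++ q | p <- f i, q <- g (n - i)%N] | i <- iota 0 n.+1].

Fixpoint tree_points (T : tree) (c : nat) : seq (seq nat) :=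
  match T with
  | Leaf y => [:: [:: y.+1 + c]]
  | Node w l r =>
      cat_points (tree_points l) (tree_points r) (w + c)
  end%N.

Lemma leaves_gt0 (T : tree) : (0 < leaves T)%N.
Proof. by elim: T => //= _ l + r _; rewrite addn_gt0 => ->. Qed.

Lemma feasible_weight (T : tree) (q : seq nat) : feasible T q -> (weight T <= sumn q)%N.
Proof. by case: T => [y|w l r] //= /and3P[]. Qed.

(** The convolution index is the excess of the left half of [q] over [weight l]; the excesses of the
    two halves add up to w + c. *)
Lemma mem_tree_points (T : tree) (c : nat) (q : seq nat) :
  (q \in tree_points T c) =
  [&& size q == leaves T, feasible T q & sumn q == (weight T + c)%N].
Proof.
elim: T c q => [y|w l IHl r IHr] c q /=.
  rewrite inE; case: q => [|x [|z q]] //=; first by rewrite addn0 eqseq_cons andbT; lia.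
  by rewrite eqseq_cons andbF.
apply/flatten_mapP/and3P => [[j]|[/eqP sq /and3P[fl fr _] /eqP sumq]].
  rewrite mem_iota add0n ltnS /= => jwc /allpairsP[[p p'] /= [+ + ->]].
  rewrite IHl IHr => /and3P[/eqP sp fp /eqP Ep] /and3P[/eqP sp' fp' /eqP Ep'].
  rewrite size_cat sp sp' eqxx take_size_cat // drop_size_cat // fp fp' /= sumn_cat Ep Ep'.
  by split=> //; [|apply/eqP]; lia.
have sumq' : sumn q = (sumn (take (leaves l) q) + sumn (drop (leaves l) q))%N.
  by rewrite -sumn_cat cat_take_drop.
have wl := feasible_weight fl; have wr := feasible_weight fr.
exists (sumn (take (leaves l) q) - weight l)%N; first by rewrite mem_iota add0n; lia.
apply/allpairsP; exists (take (leaves l) q, drop (leaves l) q).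
rewrite cat_take_drop IHl IHr fl fr size_drop size_takel sq ?leq_addr // addKn !eqxx /=.
by split=> //; apply/eqP; lia.
Qed.

(** All points of the left subtree have the same length, so a concatenation determines its halves,
    and the sum of the left half determines the convolution index. *)
Lemma tree_points_uniq (T : tree) (c : nat) : uniq (tree_points T c).
Proof.
elim: T c => [y|w l IHl r IHr] c //=.
suff H (s : seq nat) : uniq s -> uniq (flatten
    [seq [seq p ++ q | p <- tree_points l i, q <- tree_points r (w + c - i)] | i <- s]).
  exact/H/iota_uniq.
elim: s => //= i s IH /andP[iNs us]; rewrite cat_uniq IH // andbT.
have inj i1 i2 p q p' q' : p \in tree_points l i1 -> p' \in tree_points l i2 ->
    p ++ q = p' ++ q' -> [/\ p = p', q = q' & i1 = i2].
  rewrite !mem_tree_points => /and3P[/eqP sp _ /eqP Ep] /and3P[/eqP sp' _ /eqP Ep'].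
  move/eqP; rewrite eqseq_cat ?sp ?sp' // => /andP[/eqP pp' /eqP ->].
  by split=> //; move: Ep Ep'; rewrite pp' => -> /addnI.
apply/andP; split.
  apply: allpairs_uniq => // -[p q] [p' q'] /allpairsP[[p1 q1] /= [h1 _ [-> ->]]].
  by move=> /allpairsP[[p2 q2] /= [h2 _ [-> ->]]] /(inj _ _ _ _ _ _ h1 h2)[-> ->].
apply/hasPn => s' /flatten_mapP[j js /allpairsP[[p q] /= [hp _ ->]]].
apply/negP => /allpairsP[[p' q'] /= [hp' _ E]].
by have [_ _ ij] := inj _ _ _ _ _ _ hp hp' E; rewrite -ij js in iNs.
Qed.

Lemma tree_poly_points (R : realType) (T : tree) (c : nat) :
  tree_poly R T c = \sum_(q <- tree_points T c) \prod_(x <- q) narayana R x.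
Proof.
elim: T c => [y|w l IHl r IHr] c /=; first by rewrite !big_seq1.
rewrite big_flatten big_map -[iota _ _]/(index_iota 0 (w + c).+1) big_mkord.
apply: eq_bigr => i _; rewrite IHl IHr big_allpairs_dep mulr_suml.
apply: eq_bigr => p _; rewrite mulr_sumr; apply: eq_bigr => q _.
by rewrite big_cat.
Qed.

Lemma sumn_between (t s : seq nat) (m : nat) :
  all2 leq t s -> (sumn t <= m <= sumn s)%N ->
  exists u, [/\ all2 leq t u, all2 leq u s & sumn u = m].
Proof.
elim: t s m => [|x t IH] [|y s] //= m; first by case: m => // _ _; exists [::].
move=> /andP[xy ts] mts; have tsum : (sumn t <= sumn s)%N.
  elim: t s ts {IH mts} => [|a t IH] [|b s] //= /andP[ab ts].
  by rewrite leq_add // IH.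
pose z := minn y (m - sumn t).
(* Greedy choice: the first entry takes all that the lower bounds of the other entries leave over,
   up to [y]. *)
have [|u [tu us Eu]] := IH s (m - z)%N ts; first by rewrite /z; lia.
by exists (z :: u); rewrite /= tu us Eu !andbT; split; rewrite /z; lia.
Qed.

Lemma all2_leq_sumn (t s : seq nat) : all2 leq t s -> (sumn t <= sumn s)%N.
Proof. by elim: t s => [|a t IH] [|b s] //= /andP[ab ts]; rewrite leq_add // IH. Qed.

Lemma all2_leq_cat (t s t' s' : seq nat) :
  all2 leq t s -> all2 leq t' s' -> all2 leq (t ++ t') (s ++ s').
Proof. by elim: t s => [|a t IH] [|b s] //= /andP[-> /IH]. Qed.

Lemma all2_leq_take (t s : seq nat) (n : nat) :
  all2 leq t s -> all2 leq (take n t) (take n s) && all2 leq (drop n t) (drop n s).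
Proof.
elim: t s n => [|a t IH] [|b s] [|n] //= /andP[ab ts]; rewrite ab //=.
exact: IH.
Qed.

Lemma feasible_le (T : tree) (t s : seq nat) :
  all2 leq t s -> feasible T t -> feasible T s.
Proof.
elim: T t s => [y|w l IHl r IHr] t s ts /=.
  by move=> yt; apply: leq_trans yt (all2_leq_sumn ts).
have /andP[h1 h2] := all2_leq_take (leaves l) ts.
move=> /and3P[/(IHl _ _ h1)-> /(IHr _ _ h2)-> wt] /=.
exact: leq_trans wt (all2_leq_sumn ts).
Qed.

(** Both halves shrink to their minimal totals by induction. Some list between the result and [s]
    has total [weight T], and raising coordinates keeps the halves feasible. *)
Lemma feasible_shrink (T : tree) (s : seq nat) : size s = leaves T -> feasible T s ->
  exists t, [/\ all2 leq t s, feasible T t & sumn t = weight T].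
Proof.
elim: T s => [y|w l IHl r IHr] s.
  case: s => [|x [|]] //= _; rewrite addn0 => yx.
  by exists [:: y.+1]; rewrite /= addn0 yx.
move=> ss fs; have /= /and3P[fl fr wT] := fs; rewrite /= in ss.
have [|t1 [t1s ft1 E1]] := IHl _ _ fl; first by rewrite size_takel // ss leq_addr.
have [|t2 [t2s ft2 E2]] := IHr _ _ fr; first by rewrite size_drop ss addKn.
have st1 : size t1 = leaves l.
  move: t1s; rewrite all2E => /andP[/eqP-> _]; by rewrite size_takel // ss leq_addr.
have ts : all2 leq (t1 ++ t2) s.
  by rewrite -[s](cat_take_drop (leaves l)) all2_leq_cat.
have [|u [tu us Eu]] := @sumn_between _ _ (weight (Node w l r)) ts.
  by rewrite wT sumn_cat E1 E2 /= leq_addl.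
exists u; split=> //=; have /andP[h1 h2] := all2_leq_take (leaves l) tu.
rewrite take_size_cat // drop_size_cat // in h1 h2.
by rewrite (feasible_le h1 ft1) (feasible_le h2 ft2) Eu leqnn.
Qed.

(** * Weights on intervals *)

Section TreeWeights.
Variable n : nat.
Implicit Types (I J : {set 'I_n}) (Y : {set 'I_n} -> nat).

Definition itv (a b : nat) : {set 'I_n} := [set i : 'I_n | a <= i < b]%N%SET.

Lemma itv_sub a b c d : (c <= a)%N -> (b <= d)%N -> itv a b \subset itv c d.
Proof. by move=> ca bd; apply/fintype.subsetP => i; rewrite !inE; lia. Qed.

Lemma mem_itv a b i : (i \in itv a b) = (a <= i < b)%N.
Proof. by rewrite inE. Qed.

Lemma itv_subP a b c d : (a < b)%N -> (b <= n)%N ->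
  (itv a b \subset itv c d) = (c <= a)%N && (b <= d)%N.
Proof.
move=> ab bn; apply/idP/andP => [/fintype.subsetP h|[]]; last exact: itv_sub.
have an : (a < n)%N by lia.
have bn' : (b.-1 < n)%N by lia.
have := h (Ordinal an); have := h (Ordinal bn'); rewrite !inE /=; lia.
Qed.

(* The tree T, with its leaves placed at the coordinates a, a+1, ..., records
   all nonzero weights of the subsets of the interval of its leaves. *)
Fixpoint represents Y (T : tree) (a : nat) : Prop :=
  match T with
  | Leaf y => Y (itv a a.+1) = y.+1
  | Node w l r =>
      [/\ Y (itv a (a + (leaves l + leaves r))) = w, represents Y l a,
          represents Y r (a + leaves l)
        & forall I, (0 < Y I)%N -> I \subset itv a (a + (leaves l + leaves r)) ->
          [\/ I = itv a (a + (leaves l + leaves r)), I \subset itv a (a + leaves l)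
            | I \subset itv (a + leaves l) (a + (leaves l + leaves r))]]
  end.

Lemma itv1 a (h : (a < n)%N) : itv a a.+1 = [set Ordinal h]%SET.
Proof. by apply/finset.setP => i; rewrite !inE -val_eqE /=; lia. Qed.

Section Split.
Variables (V : nmodType) (f : {set 'I_n} -> V).

Lemma sum_sub_leaf a : (a < n)%N -> f finset.set0 = 0 ->
  \sum_(I : {set 'I_n} | I \subset itv a a.+1) f I = f (itv a a.+1).
Proof.
move=> an f0; rewrite (itv1 an) (bigD1 [set Ordinal an]%SET) //= big1 ?addr0 //.
by move=> I /andP[]; rewrite finset.subset1 => /orP[->//|/eqP->].
Qed.

(** Only the empty set lies in both halves, and neither half contains the whole interval, so no
    nonzero term is counted twice. *)
Lemma sum_sub_split a c b : (a < c)%N -> (c < b)%N -> (b <= n)%N ->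
  f finset.set0 = 0 ->
  (forall I, I \subset itv a b ->
    [\/ f I = 0, I = itv a b, I \subset itv a c | I \subset itv c b]) ->
  \sum_(I : {set 'I_n} | I \subset itv a b) f I =
  f (itv a b) + \sum_(I : {set 'I_n} | I \subset itv a c) f I
              + \sum_(I : {set 'I_n} | I \subset itv c b) f I.
Proof.
move=> ac cb bn f0 H; have {1}-> : f (itv a b) = \sum_(I : {set 'I_n}) (if I == itv a b then f I else 0).
  by rewrite -big_mkcond big_pred1_eq.
rewrite ![\sum_(_ | _ \subset _) _]big_mkcond -!big_split /=; apply: eq_bigr => I _.
have sac : itv a c \subset itv a b by apply: itv_sub; lia.
have scb : itv c b \subset itv a b by apply: itv_sub; lia.
case: (I =P finset.set0) => [->|/eqP I0].
  by rewrite !f0 !if_same !addr0.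
have nab : ~~ (itv a b \subset itv a c) by rewrite itv_subP; lia.
have ncb : ~~ (itv a b \subset itv c b) by rewrite itv_subP; lia.
have disj : I \subset itv a c -> I \subset itv c b -> False.
  move=> /fintype.subsetP h1 /fintype.subsetP h2; case/finset.set0Pn: I0 => i iI.
  by have := h1 i iI; have := h2 i iI; rewrite !inE; lia.
case: ifPn => [Iab|nIab]; last first.
  case: eqP => [E|_]; first by rewrite E subxx in nIab.
  have nsub J : J \subset itv a b -> (I \subset J) = false.
    by move=> Jab; apply: contraNF nIab => /fintype.subset_trans; apply.
  by rewrite !nsub // !addr0.
case: (H I Iab) => [->|->|h|h].
- by rewrite !if_same !addr0.
- by rewrite eqxx (negbTE nab) (negbTE ncb) !addr0.
- rewrite h; case: eqP => [E|_]; first by rewrite E (negbTE nab) in h.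
  by case: ifP => [/(disj h)//|_]; rewrite add0r addr0.
- rewrite h; case: eqP => [E|_]; first by rewrite E (negbTE ncb) in h.
  by case: ifP => [/disj/(_ h)//|_]; rewrite !add0r.
Qed.

End Split.

Lemma represents_weight Y T a : Y finset.set0 = 0%N -> (a + leaves T <= n)%N ->
  represents Y T a ->
  (\sum_(I : {set 'I_n} | I \subset itv a (a + leaves T)) Y I)%N = weight T.
Proof.
move=> Y0; elim: T a => [y|w l IHl r IHr] a an /=.
  by move=> <-; rewrite /= addn1 in an *; apply: (sum_sub_leaf (V := nat)).
move=> [Yw rl rr H]; rewrite /= in an.
have lpos := leaves_gt0 l; have rpos := leaves_gt0 r.
rewrite (sum_sub_split (V := nat) (c := a + leaves l)%N) //; try lia.
  rewrite Yw IHl //; last lia.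
  by rewrite addnA IHr -?addnA ?addnA //; lia.
move=> I hI; case: (posnP (Y I)) => [->|/H/(_ hI)[]]; first by constructor 1.
- by constructor 2.
- by constructor 3.
- by constructor 4.
Qed.

End TreeWeights.

(** * Feasible points and their decomposition into shares of the weighted intervals *)

Section Points.
Variable n : nat.
Implicit Types (I J : {set 'I_n}) (Y : {set 'I_n} -> nat).

Lemma sum_itv_nat (f : nat -> nat) a b : (b <= n)%N ->
  (\sum_(i in itv n a b) f i = \sum_(a <= i < b) f i)%N.
Proof.
move=> bn; rewrite big_geq_mkord (big_ord_widen_cond _ (fun i => a <= i)%N f bn).
by apply: eq_bigl => i; rewrite mem_itv.
Qed.

Lemma sum_itv (s : seq nat) a b : size s = n -> (a <= b)%N -> (b <= n)%N ->
  (\sum_(i in itv n a b) nth 0 s i)%N = sumn (take (b - a) (drop a s)).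
Proof.
move=> sn ab bn; have sz : size (take (b - a) (drop a s)) = (b - a)%N.
  by rewrite size_takel // size_drop sn leq_sub2r.
rewrite sum_itv_nat // -{1}[a]add0n big_addn sumnE [RHS](big_nth 0%N) sz; apply: eq_big_nat => i ib.
by rewrite nth_take ?nth_drop 1?addnC.
Qed.

(** The inequality for the interval of a node is the condition at that node, as [represents_weight]
    evaluates its left side. *)
Lemma feasible_of_sums Y T a (s : seq nat) : Y finset.set0 = 0%N -> size s = n ->
  (forall J, \sum_(I : {set 'I_n} | I \subset J) Y I <= \sum_(i in J) nth 0 s i)%N ->
  (a + leaves T <= n)%N -> represents Y T a ->
  feasible T (take (leaves T) (drop a s)).
Proof.
move=> Y0 sn H; elim: T a => [y|w l IHl r IHr] a an rT.
  have := H (itv n a (a + 1)); rewrite (represents_weight (T := Leaf y)) //.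
  by rewrite sum_itv ?leq_addr // addKn.
have := H (itv n a (a + leaves (Node w l r))); rewrite represents_weight //.
rewrite sum_itv ?leq_addr // addKn /= => ->; rewrite andbT.
move: rT an => /= [_ rl rr _] an.
rewrite take_takel ?leq_addr // IHl //=; last lia.
by rewrite [(leaves l + leaves r)%N]addnC -take_drop drop_drop [(leaves l + a)%N]addnC IHr //; lia.
Qed.

Lemma all2_leq_nth (t s : seq nat) j : all2 leq t s -> (nth 0 t j <= nth 0 s j)%N.
Proof.
by elim: t s j => [|x t IH] [|y s] [|j] //= /andP[xy ts] //; apply: IH.
Qed.

(* By induction on [T]: shrink the two halves of [s] to minimal total; what has
   been removed is the share of the root. *)
Lemma distribute Y T a (s : seq nat) : Y finset.set0 = 0%N ->
  (a + leaves T <= n)%N -> represents Y T a ->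
  size s = leaves T -> feasible T s -> sumn s = weight T ->
  exists u : {set 'I_n} -> 'I_n -> nat,
    [/\ forall I i, i \notin I -> u I i = 0%N,
        forall I, I \subset itv n a (a + leaves T) -> (\sum_i u I i = Y I)%N
      & forall i : 'I_n, (a <= i < a + leaves T)%N ->
         (\sum_(I : {set 'I_n} | I \subset itv n a (a + leaves T)) u I i)%N
         = nth 0%N s (i - a)].
Proof.
move=> Y0; elim: T a s => [y|w l IHl r IHr] a s an.
  case: s => [|x [|? ?]] //= rT _ _; rewrite addn0 => Ex; rewrite /= addn1 in an.
  exists (fun I i => if (I == itv n a a.+1) && (i \in I) then x else 0%N).
  rewrite addn1; split=> [I i /negbTE->|I|i ai]; first by rewrite andbF.
    rewrite (itv1 an) finset.subset1 => /orP[/eqP->|/eqP->].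
      rewrite -(itv1 an) rT -Ex (itv1 an) eqxx /= -big_mkcond /=.
      by rewrite finset.big_set1.
    rewrite Y0 big1 // => i _; by rewrite finset.in_set0 andbF.
  rewrite (sum_sub_leaf (V := nat)) // ?finset.in_set0 ?andbF //.
  have -> : i = Ordinal an by apply: val_inj => /=; lia.
  by rewrite eqxx mem_itv /= leqnn ltnSn subnn.
move=> rT ss fs Es; have /= [Yw rl rr HY] := rT; rewrite /= in an.
have [t [ts ft Et]] : exists t, [/\ all2 leq t s, size t = leaves (Node w l r) /\ 
  feasible l (take (leaves l) t) /\ feasible r (drop (leaves l) t) & 
  sumn (take (leaves l) t) = weight l /\ sumn (drop (leaves l) t) = weight r].
  have /= /and3P[fl fr _] := fs; rewrite /= in ss.
  have [|t1 [t1s ft1 E1]] := feasible_shrink _ fl; first by rewrite size_takel // ss leq_addr.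
  have [|t2 [t2s ft2 E2]] := feasible_shrink _ fr; first by rewrite size_drop ss addKn.
  have st1 : size t1 = leaves l.
    by move: t1s; rewrite all2E => /andP[/eqP-> _]; rewrite size_takel // ss leq_addr.
  have st2 : size t2 = leaves r.
    by move: t2s; rewrite all2E => /andP[/eqP-> _]; rewrite size_drop ss addKn.
  exists (t1 ++ t2); rewrite take_size_cat // drop_size_cat // size_cat st1 st2; split=> //.
  by rewrite -[s](cat_take_drop (leaves l)) all2_leq_cat.
case: ft => st [fl fr]; case: Et => El Er; rewrite /= in ss st.
have lpos := leaves_gt0 l; have rpos := leaves_gt0 r.
have [||u1 [u1z u1Y u1s]] := IHl a _ _ rl _ fl El; first lia.
  by rewrite size_takel // st leq_addr.
have [||u2 [u2z u2Y u2s]] := IHr (a + leaves l)%N _ _ rr _ fr Er; first lia.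
  by rewrite size_drop st addKn.
set b := (a + (leaves l + leaves r))%N in an HY Yw *.
set c := (a + leaves l)%N in rr u1Y u1s u2Y u2s HY *.
have bE : (c + leaves r = b)%N by rewrite /b /c addnA.
rewrite bE in u2Y u2s.
(* The root receives what was removed from [s]; the subsets of the halves keep the shares found by
   induction. *)
pose u I i := if I == itv n a b then
                if i \in I then (nth 0 s (i - a) - nth 0 t (i - a))%N else 0%N
              else if I \subset itv n a c then u1 I i
              else if I \subset itv n c b then u2 I i else 0%N.
have ts_le j := all2_leq_nth j ts.
(* The amount removed is weight T - (weight l + weight r) = w. *)
have sum_st : (\sum_(i in itv n a b) (nth 0 s (i - a) - nth 0 t (i - a)) = w)%N.
  rewrite (sum_itv_nat (fun i => nth 0 s (i - a) - nth 0 t (i - a))%N) //.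
  rewrite -{1}[a]add0n big_addn (_ : (b - a)%N = size s); last by rewrite ss /b addKn.
  under eq_bigr do rewrite addnK.
  rewrite sumnB; last by move=> j _; apply: ts_le.
  rewrite {2}ss -st -(big_nth 0%N xpredT id) -(big_nth 0%N xpredT id) -!sumnE Es.
  by rewrite -[t](cat_take_drop (leaves l)) sumn_cat El Er /= addnK.
have nab J : J \subset itv n a c -> J != itv n a b.
  by move=> h; apply: contraTneq h => ->; rewrite itv_subP /b /c; lia.
have ncb J : J \subset itv n c b -> J != itv n a b.
  by move=> h; apply: contraTneq h => ->; rewrite itv_subP /b /c; lia.
have u_z I i : i \notin I -> u I i = 0%N.
  by move=> iI; rewrite /u (negbTE iI) u1z // u2z // !if_same.
have u_ac I i : I \subset itv n a c -> u I i = u1 I i.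
  by move=> h; rewrite /u (negbTE (nab _ h)) h.
have u_cb I i : I \subset itv n c b -> u I i = u2 I i.
  move=> h; rewrite /u (negbTE (ncb _ h)) h; case: ifP => // h'.
  have iI : i \notin I.
    apply/negP => iI; move/fintype.subsetP/(_ i iI): h; move/fintype.subsetP/(_ i iI): h'.
    by rewrite !mem_itv; lia.
  by rewrite u1z ?u2z.
have uY I : I \subset itv n a b -> (\sum_i u I i)%N = Y I.
  move=> hI; case: (I =P itv n a b) => [->|/eqP nI].
    by rewrite Yw -sum_st [RHS]big_mkcond; apply: eq_bigr => i _; rewrite /u eqxx.
  case: (boolP (I \subset itv n a c)) => [h|nac].
    by rewrite -u1Y //; apply: eq_bigr => i _; rewrite u_ac.
  case: (boolP (I \subset itv n c b)) => [h|ncb'].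
    by rewrite -u2Y //; apply: eq_bigr => i _; rewrite u_cb.
  rewrite big1; last by move=> i _; rewrite /u (negbTE nI) (negbTE nac) (negbTE ncb').
  case: (posnP (Y I)) => // /HY/(_ hI)[E|h|h]; first by rewrite E eqxx in nI.
    by rewrite h in nac.
  by rewrite h in ncb'.
exists u; split=> // i iab.
rewrite (sum_sub_split (V := nat) (c := c) (f := fun I => u I i)); rewrite /b /c; try lia.
- rewrite -/b -/c.
  rewrite (eq_bigr (fun I => u1 I i)); last by move=> I h; rewrite u_ac.
  rewrite [X in (_ + X)%R](eq_bigr (fun I => u2 I i)); last by move=> I h; rewrite u_cb.
  have -> : u (itv n a b) i = (nth 0 s (i - a) - nth 0 t (i - a))%N.
    by rewrite /u eqxx mem_itv iab.
  have notin J d e : J \subset itv n d e -> ~~ (d <= i < e)%N -> i \notin J.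
    by move=> /fintype.subsetP h; apply: contra => /h; rewrite mem_itv.
  case: (ltnP i c) => ic.
    rewrite u1s; last lia.
    rewrite [X in (_ + X)%R]big1; last first.
      by move=> I hI; rewrite u2z // (notin _ _ _ hI) //; lia.
    rewrite nth_take; last by rewrite /c in ic; lia.
    by rewrite [LHS]addn0 [LHS]subnK.
  rewrite u2s; last lia.
  rewrite [X in (_ + X + _)%R]big1; last first.
    by move=> I hI; rewrite u1z // (notin _ _ _ hI) //; lia.
  rewrite nth_drop (_ : (leaves l + (i - c) = i - a)%N); last by rewrite /c in ic *; lia.
  by rewrite [(_ + 0)%R]addn0 [LHS]subnK.
- by rewrite u_z // finset.in_set0.
- rewrite -/b -/c => I hI; case: (posnP (Y I)) => [YI|/HY/(_ hI)[]].
  + constructor 1; move/eqP: (uY I hI); rewrite YI sum_nat_eq0 => /forallP/(_ i)/eqP.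
    by [].
  + by constructor 2.
  + by constructor 3.
  + by constructor 4.
Qed.

End Points.

(** * Lattice points of nestohedra *)

Section Nestohedra.
Local Open Scope classical_set_scope.
Variables (R : realType) (k : nat).
Implicit Types (I J : {set 'I_k.+1}) (Y : {set 'I_k.+1} -> nat) (v x : 'rV[R]_k.+1).

Lemma simplexP I v : simplex I v <->
  [/\ forall i, 0 <= v 0 i, forall i, i \notin I -> v 0 i = 0 & \sum_i v 0 i = 1].
Proof.
have vE (w : 'I_k.+1 -> R) j : (\sum_(i in I) w i *: delta_mx 0 i : 'rV[R]__) 0 j
    = if j \in I then w j else 0.
  rewrite summxE big_mkcond (bigD1 j) //= big1 => [|i ij].
    by rewrite !mxE !eqxx mulr1 addr0.
  by case: ifP => // _; rewrite !mxE eq_sym (negbTE ij) andbF mulr0.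
split=> [[w [w0 w1 ->]]|[v0 vI v1]].
  split=> [i|i /negbTE iI|]; rewrite ?vE ?iI //; first by case: ifP => // /w0.
  by rewrite -w1 [RHS]big_mkcond; apply: eq_bigr => i _; rewrite vE.
exists (fun i => v 0 i); split=> //.
  rewrite -v1 [LHS]big_mkcond; apply: eq_bigr => i _.
  by case: ifPn => // /vI ->.
by apply/rowP => i; rewrite vE; case: ifPn => // /vI.
Qed.

(** Taking the support lets one function [Y] encode both a building set and its weights, with 0 for
    absent sets. *)
Definition weight_support Y : {set {set 'I_k.+1}} := [set I | 0 < Y I]%N%SET.

Definition nestohedron Y : set 'rV[R]_k.+1 :=
  weighted_minkowski_sum (weight_support Y) (fun I => (Y I)%:R).

Definition row_of_seq (s : seq nat) : 'rV[int]_k.+1 := \row_i (nth 0%N s i)%:Z.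

(** On [J], a point of the simplex of [I] has total 1 if [I] lies in [J], and nonnegative total in
    any case. *)
Lemma minkowski_sum_ge (B : {set {set 'I_k.+1}}) (y : {set 'I_k.+1} -> R) x J :
  (forall I, I \in B -> 0 <= y I) -> weighted_minkowski_sum B y x ->
  \sum_(I in B | I \subset J) y I <= \sum_(i in J) x 0 i.
Proof.
move=> y0 [v [vs ->]].
have -> : \sum_(i in J) (\sum_(I in B) y I *: v I) 0 i =
    \sum_(I in B) y I * \sum_(i in J) v I 0 i.
  under eq_bigr do rewrite summxE.
  rewrite exchange_big; apply: eq_bigr => I _; rewrite mulr_sumr.
  by apply: eq_bigr => i _; rewrite mxE.
rewrite big_mkcondr; apply: ler_sum => I IB.
have /simplexP[v0 vI v1] := vs I IB.
case: ifPn => [/fintype.subsetP IJ|_]; last by rewrite mulr_ge0 ?y0 ?sumr_ge0.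
rewrite (_ : \sum_(i in J) _ = 1) ?mulr1 // -v1 big_mkcond.
apply: eq_bigr => i _; case: ifPn => // iJ; rewrite vI //.
by apply: contra iJ => /IJ.
Qed.

Lemma minkowski_sum_total (B : {set {set 'I_k.+1}}) (y : {set 'I_k.+1} -> R) x :
  weighted_minkowski_sum B y x -> \sum_i x 0 i = \sum_(I in B) y I.
Proof.
move=> [v [vs ->]]; under eq_bigr do rewrite summxE.
rewrite exchange_big; apply: eq_bigr => I IB.
have /simplexP[_ _ v1] := vs I IB.
by rewrite -[RHS]mulr1 -v1 mulr_sumr; apply: eq_bigr => i _; rewrite mxE.
Qed.

Lemma sub_full I : I \subset itv k.+1 0 k.+1.
Proof. by apply/fintype.subsetP => i _; rewrite mem_itv /=. Qed.

(** One inclusion is the system of inequalities over subsets. For the other, [distribute] splits a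
    point into shares [u I] of total [Y I]; divided by [Y I], each share is a point of the simplex
    of [I]. *)
Lemma lattice_points_tree Y T : Y finset.set0 = 0%N -> leaves T = k.+1 ->
  represents Y T 0 ->
  lattice_points (nestohedron Y) = row_of_seq @` [set` tree_points T 0].
Proof.
move=> Y0 lT rT.
have wT : (\sum_(I : {set 'I_k.+1}) Y I)%N = weight T.
  rewrite -(represents_weight Y0 _ rT) ?add0n ?lT //.
  by apply: eq_bigl => I; rewrite sub_full.
have sumY (Q : pred {set 'I_k.+1}) :
    \sum_(I in weight_support Y | Q I) (Y I)%:R = (\sum_(I | Q I) Y I)%N%:R :> R.
  rewrite natr_sum big_mkcondl; apply: eq_bigr => I _; rewrite inE.
  by case: posnP => [->|].
apply/seteqP; split=> [q Pq|_ [s /= hs <-]].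
  have ge J : ((\sum_(I : {set 'I_k.+1} | I \subset J) Y I)%N%:R : R) <= \sum_(i in J) (q 0 i)%:~R.
    rewrite -sumY; have := minkowski_sum_ge J _ Pq; move/(_ (fun _ _ => ler0n _ _)).
    by move/le_trans; apply; apply: ler_sum => i _; rewrite mxE.
  have q0 i : 0 <= q 0 i.
    have := ge [set i]%SET; rewrite big_set1; move/(le_trans (ler0n _ _)).
    by rewrite ler0z.
  have qabs i : ((absz (q 0 i))%:R : R) = (q 0 i)%:~R.
    by rewrite pmulrn gez0_abs.
  have [s [ss ns]] : exists s, size s = k.+1 /\
      forall i : 'I_k.+1, nth 0%N s i = absz (q 0 i).
    exists (mkseq (fun i => absz (q 0 (inord i))) k.+1); rewrite size_mkseq.
    by split=> // i; rewrite nth_mkseq // inord_val.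
  exists s; last by apply/rowP => i; rewrite mxE ns gez0_abs.
  rewrite /= mem_tree_points addn0 ss lT eqxx /=; apply/andP; split.
    have := @feasible_of_sums _ Y T 0 s Y0 ss; rewrite drop0 take_oversize ?ss ?lT //.
    apply=> //; move=> J; rewrite -(ler_nat R); apply: le_trans (ge J) _.
    by rewrite natr_sum; apply: ler_sum => i _; rewrite ns qabs.
  rewrite -wT -(eqr_nat R) -[(\sum_I Y I)%N%:R]sumY.
  rewrite (eq_bigl (fun I => I \in weight_support Y)); last by move=> I; rewrite andbT.
  rewrite -(minkowski_sum_total Pq).
  have -> : sumn s = (\sum_(i < k.+1) nth 0 s i)%N.
    by rewrite sumnE (big_nth 0%N) ss big_mkord.
  by rewrite natr_sum; apply/eqP; apply: eq_bigr => i _; rewrite mxE ns qabs.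
move: hs; rewrite mem_tree_points addn0 => /and3P[/eqP ss fs /eqP Es].
have [|u [uz uY us]] := distribute Y0 _ rT ss fs Es; first by rewrite lT.
rewrite add0n lT in uY us.
have uY' I : (\sum_i u I i)%N = Y I by rewrite uY ?sub_full.
exists (fun I => \row_i ((u I i)%:R / (Y I)%:R)); split.
  move=> I; rewrite inE => YI; apply/simplexP; split.
  - by move=> i; rewrite mxE divr_ge0.
  - by move=> i /uz ui; rewrite mxE ui mul0r.
  under eq_bigr do rewrite mxE.
  by rewrite -mulr_suml -natr_sum uY' divff // pnatr_eq0 -lt0n.
apply/rowP => i; rewrite !mxE summxE.
have -> : nth 0%N s i =
    (\sum_(I : {set 'I_k.+1} | I \subset itv k.+1 0 k.+1) u I i)%N.
  by rewrite us ?subn0 /=.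
rewrite -pmulrn natr_sum (eq_bigl xpredT); last by move=> I; rewrite sub_full.
rewrite [RHS]big_mkcond; apply: eq_bigr => I _; rewrite inE !mxE.
case: posnP => [YI|YI].
  by move/eqP: (uY' I); rewrite YI sum_nat_eq0 => /forallP/(_ i)/eqP/= ->.
by rewrite mulrC divfK // pnatr_eq0 -lt0n.
Qed.

Lemma lattice_poly_tree Y T : Y finset.set0 = 0%N -> leaves T = k.+1 ->
  represents Y T 0 -> lattice_poly (nestohedron Y) = tree_poly R T 0.
Proof.
move=> Y0 lT rT; rewrite /lattice_poly (lattice_points_tree Y0 lT rT) tree_poly_points.
have sz s : s \in tree_points T 0 -> size s = k.+1.
  by rewrite mem_tree_points lT => /and3P[/eqP].
have inj : {in tree_points T 0 &, injective row_of_seq}.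
  move=> s t /sz ss /sz st E; apply: (@eq_from_nth _ 0%N); rewrite ?ss ?st // => i ik.
  by have := congr1 (fun q : 'rV[int]__ => q 0 (Ordinal ik)) E; rewrite !mxE => -[].
rewrite (_ : _ @` _ = [set` map row_of_seq (tree_points T 0)]); last first.
  apply/seteqP; split=> [_ [s hs <-]|q /= /mapP[s hs ->]].
    by rewrite /= map_f.
  by exists s.
rewrite -fsbig_seq ?map_inj_in_uniq ?tree_points_uniq // big_map.
apply: eq_big_seq => s /sz ss; rewrite /narayana_prod (big_nth 0%N) ss big_mkord.
by apply: eq_bigr => i _; rewrite mxE.
Qed.

End Nestohedra.

(** * Vertices and integrality *)

Section Vertices.
Variables (R : realType) (k : nat).
Implicit Types (I J : {set 'I_k.+1}) (B : {set {set 'I_k.+1}}) (c : 'cV[R]_k.+1).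

Definition delta_row (i : 'I_k.+1) : 'rV[R]_k.+1 := delta_mx 0 i.

Lemma delta_row_mul i c : (delta_row i *m c) 0 0 = c i 0.
Proof. by rewrite -rowE mxE. Qed.

Lemma simplex_delta_row I i : i \in I -> simplex I (delta_row i).
Proof.
move=> iI; apply/simplexP; split=> [j|j jI|].
- by rewrite mxE eqxx ler0n.
- by rewrite mxE (_ : (j == i) = false) ?andbF //; apply: contraNF jI => /eqP->.
- rewrite (bigD1 i) //= big1 => [|j ji]; rewrite mxE ?eqxx ?addr0 //.
  by rewrite (negbTE ji) andbF.
Qed.

(** Writing the gap as a combination of the gaps at the vertices gives both the bound and its
    equality case. *)
Lemma simplex_gap I (v : 'rV[R]_k.+1) c m : simplex I v ->
  c m 0 - (v *m c) 0 0 = \sum_(i in I) v 0 i * (c m 0 - c i 0).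
Proof.
move=> /simplexP[v0 vI v1]; rewrite mxE -[c m 0 in LHS]mul1r -v1 mulr_suml -sumrB.
rewrite [RHS]big_mkcond; apply: eq_bigr => i _; rewrite -mulrBr.
by case: ifPn => // /vI ->; rewrite mul0r.
Qed.

Lemma simplex_mul_le I (v : 'rV[R]_k.+1) c m : simplex I v ->
  (forall i, i \in I -> c i 0 <= c m 0) -> (v *m c) 0 0 <= c m 0.
Proof.
move=> Iv cm; rewrite -subr_ge0 (simplex_gap c m Iv); apply: sumr_ge0 => i iI.
by rewrite mulr_ge0 ?subr_ge0 ?cm //; have /simplexP[] := Iv.
Qed.

Lemma simplex_mul_eq I (v : 'rV[R]_k.+1) c m : simplex I v -> m \in I ->
  (forall i, i \in I -> i != m -> c i 0 < c m 0) -> c m 0 <= (v *m c) 0 0 ->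
  v = delta_row m.
Proof.
move=> Iv mI cm le; have /simplexP[v0 vI v1] := Iv.
have cm' i : i \in I -> c i 0 <= c m 0.
  by move=> iI; case: (eqVneq i m) => [->//|/(cm i iI)/ltW].
have gap0 : \sum_(i in I) v 0 i * (c m 0 - c i 0) = 0.
  by rewrite -(simplex_gap c m Iv); apply/eqP; rewrite subr_eq0 eq_le le (simplex_mul_le Iv cm').
have vz i : i != m -> v 0 i = 0.
  move=> im; case: (boolP (i \in I)) => [iI|/vI//].
  have := psumr_eq0P _ gap0; move/(_ _ i iI)/eqP; rewrite mulf_eq0 subr_eq0.
  rewrite (gt_eqF (cm i iI im)) orbF => H; apply/eqP; apply: H => j jI.
  by rewrite mulr_ge0 ?subr_ge0 ?cm'.
have vm : v 0 m = 1.
  by rewrite -v1 (bigD1 m) //= big1 ?addr0.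
apply/rowP => i; rewrite mxE eqxx /=; case: (eqVneq i m) => [->//|/vz ->//].
Qed.

Lemma exists_argmax B c : (forall I, I \in B -> I != finset.set0) ->
  exists m : {set 'I_k.+1} -> 'I_k.+1, forall I, I \in B ->
    m I \in I /\ forall i, i \in I -> c i 0 <= c (m I) 0.
Proof.
move=> B0; have [|m H] := @choice _ _ (fun I m => I \in B ->
    m \in I /\ forall i, i \in I -> c i 0 <= c m 0); last by exists m.
move=> I; case: (boolP (I \in B)) => [IB|_]; last by exists ord0.
have /finset.set0Pn[i0 i0I] := B0 I IB.
exists [arg max_(i > i0 in I) c i 0]%O => _.
by case: Order.TotalTheory.arg_maxP => // i iI H; split.
Qed.

Lemma greedy_in B (y : {set 'I_k.+1} -> R) m : (forall I, I \in B -> m I \in I) ->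
  weighted_minkowski_sum B y (\sum_(I in B) y I *: delta_row (m I)).
Proof.
by move=> mI; exists (fun I => delta_row (m I)); split=> // I /mI/simplex_delta_row.
Qed.

Lemma sum_scale_mul B (y : {set 'I_k.+1} -> R) (v : {set 'I_k.+1} -> 'rV[R]_k.+1) c :
  ((\sum_(I in B) y I *: v I) *m c) 0 0 = \sum_(I in B) y I * (v I *m c) 0 0.
Proof.
by rewrite mulmx_suml summxE; apply: eq_bigr => I _; rewrite -scalemxAl mxE.
Qed.

(** Picking a maximizing vertex in every simplex gives a point where the functional exposing [x] is
    maximal. So [x] is this integer combination of unit vectors. *)
Lemma vertex_integral (Y : {set 'I_k.+1} -> nat) (x : 'rV[R]_k.+1) :
  Y finset.set0 = 0%N -> is_vertex (nestohedron Y) x ->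
  exists q : 'rV[int]_k.+1, x = map_mx intr q.
Proof.
move=> Y0 [Px [c cx]].
have B0 I : I \in weight_support Y -> I != finset.set0.
  by rewrite inE; apply: contraTneq => ->; rewrite Y0.
have [m mP] := @exists_argmax (weight_support Y) c B0.
pose x' := \sum_(I in weight_support Y) (Y I)%:R *: delta_row (m I).
have Px' : nestohedron Y x' by apply: greedy_in => I /mP[].
exists (\sum_(I in weight_support Y) (Y I)%:Z *: delta_mx 0 (m I)).
have -> : x = x'.
  apply: contrapT => xx'; have := cx x' Px' (fun E => xx' (esym E)).
  apply/negP; rewrite -leNgt; case: (Px) => v [vs ->].
  rewrite !sum_scale_mul; apply: ler_sum => I IB; apply: ler_wpM2l => //.
  rewrite delta_row_mul; have [_ H] := mP I IB.
  exact: simplex_mul_le (vs I IB) H.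
apply/rowP => i; rewrite !mxE !summxE raddf_sum; apply: eq_bigr => I _.
by rewrite !mxE /= intrM -pmulrn; congr (_ * _); case: (_ == _).
Qed.

(** A point of the Minkowski sum maximizes the functional only if each summand does, and strictness
    leaves one choice per summand. *)
Lemma greedy_vertex B (y : {set 'I_k.+1} -> R) c m :
  (forall I, I \in B -> 0 < y I) ->
  (forall I, I \in B -> m I \in I /\ forall i, i \in I -> i != m I -> c i 0 < c (m I) 0) ->
  is_vertex (weighted_minkowski_sum B y) (\sum_(I in B) y I *: delta_row (m I)).
Proof.
move=> y0 mP; split; first by apply: greedy_in => I /mP[].
exists c => z [v [vs ->]] zx.
rewrite ltNge; apply/negP; rewrite !sum_scale_mul => le; apply: zx.
have le_vm I : I \in B -> y I * (v I *m c) 0 0 <= y I * (delta_row (m I) *m c) 0 0.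
  move=> IB; rewrite ler_pM2l ?y0 // delta_row_mul; apply: simplex_mul_le (vs I IB) _.
  have [mI H] := mP I IB; move=> i iI.
  by case: (eqVneq i (m I)) => [->//|/(H i iI)/ltW].
apply: eq_bigr => I IB; congr (_ *: _); have [mI H] := mP I IB.
apply: (simplex_mul_eq (vs I IB) mI H).
rewrite -(ler_pM2l (y0 I IB)) -[X in y I * X]delta_row_mul.
rewrite -subr_le0 le_eqVlt; apply/orP; left.
pose D I' := y I' * (delta_row (m I') *m c) 0 0 - y I' * (v I' *m c) 0 0.
have D0 I' : I' \in B -> 0 <= D I' by move=> IB'; rewrite subr_ge0 le_vm.
have sD : \sum_(I' in B) D I' = 0.
  by apply: le_anti; rewrite sumr_ge0 // sumrB subr_le0 le.
by apply/eqP; apply: (psumr_eq0P D0 sD).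
Qed.

(* Minimizing the total over [J] first, a functional singles out the vertex at
   which this total is the sum of the weights of the subsets of [J]. *)
Lemma integral_weights B (y : {set 'I_k.+1} -> R) :
  (forall I, I \in B -> I != finset.set0) -> (forall I, I \in B -> 0 < y I) ->
  (forall x, is_vertex (weighted_minkowski_sum B y) x ->
     exists q : 'rV[int]_k.+1, x = map_mx intr q) ->
  forall I, I \in B -> y I \is a Num.int.
Proof.
move=> B0 y0 int_vertex.
have zJ J : \sum_(I in B | I \subset J) y I \is a Num.int.
  (* Coordinates outside [J] get values above [k], those inside at most [k], and [i] breaks ties. So
     the maximizer over [I] lies in [J] only if [I] does. *)
  pose c : 'cV[R]_k.+1 := \col_i (i + k.+1 * (i \notin J))%N%:R.
  have cinj i j : c i 0 = c j 0 -> i = j.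
    rewrite !mxE => /eqP; rewrite eqr_nat => /eqP E; apply: val_inj => /=.
    by have := ltn_ord i; have := ltn_ord j; move: E; do 2!case: (_ \notin J); lia.
  have [m mP] := @exists_argmax _ c B0.
  have mP' I : I \in B -> m I \in I /\ forall i, i \in I -> i != m I -> c i 0 < c (m I) 0.
    move=> IB; have [mI H] := mP I IB; split=> // i iI im.
    by rewrite lt_neqAle H // andbT; apply: contra im => /eqP/cinj->.
  have [q Eq] := int_vertex _ (greedy_vertex y0 mP').
  have -> : \sum_(I in B | I \subset J) y I =
      \sum_(i in J) (\sum_(I in B) y I *: delta_row (m I)) 0 i.
    under [RHS]eq_bigr do rewrite summxE.
    rewrite exchange_big big_mkcondr; apply: eq_bigr => I IB.
    have [mI H] := mP' I IB.
    under [RHS]eq_bigr do rewrite !mxE eqxx /=.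
    have -> : (I \subset J) = (m I \in J).
      apply/idP/idP => [/fintype.subsetP/(_ _ mI)//|mJ].
      apply/fintype.subsetP => i iI; apply: contraT => iJ.
      have im : i != m I by apply: contraNneq iJ => ->.
      have := H i iI im; rewrite !mxE ltr_nat mJ iJ.
      by have := ltn_ord (m I); lia.
    case: ifPn => [mJ|mJ].
      rewrite (bigD1 (m I)) //= eqxx mulr1 big1 ?addr0 // => i /andP[_ im].
      by rewrite (negbTE im) mulr0.
    rewrite big1 // => i iJ; rewrite (_ : i == m I = false) ?mulr0 //.
    by apply: contraNF mJ => /eqP<-.
  by rewrite Eq; apply: rpred_sum => i _; rewrite mxE intr_int.
(* Subtracting the weights of the proper subsets of [I], integers by induction on cardinality,
   isolates [y I]. *)
move=> I; move En : #|I| => n; elim/ltn_ind: n I En => n IH I En IB.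
have := zJ I; rewrite (bigD1 I) ?IB //= => h.
rewrite -(addrK (\sum_(J | (J \in B) && (J \subset I) && (J != I)) y J) (y I)).
apply: rpredB => //; apply: rpred_sum => J /andP[/andP[JB JI] nJ].
apply: (IH #|J|) => //; rewrite -En proper_card //.
by rewrite finset.properEneq nJ JI.
Qed.

End Vertices.

(** * Binary building sets and trees *)

Section TreesOfBuildingSets.
Variable n : nat.
Implicit Types (I J : {set 'I_n}) (Y : {set 'I_n} -> nat).

Fixpoint tree_weights (T : tree) (a : nat) I : nat :=
  match T with
  | Leaf y => if I == itv n a a.+1 then y.+1 else 0
  | Node w l r =>
      (if I == itv n a (a + (leaves l + leaves r)) then w else 0)
      + (tree_weights l a I + tree_weights r (a + leaves l) I)
  end%N.

Lemma tree_weights_itv T a I : (0 < tree_weights T a I)%N ->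
  exists i j, [/\ I = itv n i j, (a <= i)%N, (i < j)%N & (j <= a + leaves T)%N].
Proof.
elim: T a => [y|w l IHl r IHr] a /=.
  by case: eqP => // -> _; exists a, a.+1; rewrite addn1.
have lpos := leaves_gt0 l; have rpos := leaves_gt0 r.
rewrite !addn_gt0 => /or3P[|/IHl|/IHr].
- by case: eqP => // -> _; exists a, (a + (leaves l + leaves r))%N; split=> //; lia.
- by move=> [i [j [-> ai ij jl]]]; exists i, j; split=> //; lia.
- by move=> [i [j [-> ai ij jl]]]; exists i, j; split=> //; lia.
Qed.

Lemma tree_weights_sub T a I : (0 < tree_weights T a I)%N ->
  I \subset itv n a (a + leaves T).
Proof. by move=> /tree_weights_itv[i [j [-> ai ij jl]]]; apply: itv_sub. Qed.

Lemma tree_weights_neq0 T a I : (a + leaves T <= n)%N -> (0 < tree_weights T a I)%N ->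
  I != finset.set0.
Proof.
move=> an /tree_weights_itv[i [j [-> ai ij jl]]].
have hi : (i < n)%N by lia.
by apply/finset.set0Pn; exists (Ordinal hi); rewrite mem_itv /= leqnn.
Qed.

Lemma tree_weights1 T a (i : 'I_n) : (a <= i < a + leaves T)%N ->
  (0 < tree_weights T a [set i]%SET)%N.
Proof.
elim: T a => [y|w l IHl r IHr] a /= ai.
  rewrite (_ : [set i]%SET = itv n a a.+1) ?eqxx //.
  by apply/finset.setP => j; rewrite !inE -val_eqE /=; lia.
rewrite !addn_gt0; case: (ltnP i (a + leaves l)%N) => h.
  by rewrite IHl ?orbT //; lia.
by rewrite IHr ?orbT //; lia.
Qed.

Lemma itv_disjoint a c b I J : I \subset itv n a c -> J \subset itv n c b ->
  [disjoint I & J].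
Proof.
move=> /fintype.subsetP hI /fintype.subsetP hJ; apply/pred0P => i /=.
apply/negP => /andP[/hI + /hJ]; rewrite !mem_itv; lia.
Qed.

Lemma tree_weights_nested T a I J : (0 < tree_weights T a I)%N ->
  (0 < tree_weights T a J)%N -> ~~ [disjoint I & J] -> I \subset J \/ J \subset I.
Proof.
elim: T a => [y|w l IHl r IHr] a hI hJ.
  move: hI hJ => /=; case: eqP => // -> _; case: eqP => // -> _ _.
  by left.
have := tree_weights_sub hI; have := tree_weights_sub hJ.
move: hI hJ; rewrite /= !addn_gt0.
case: eqP => [-> _ _ Jab _|_]; first by right.
case: eqP => [-> _ _ _ Iab|_]; first by left.
move=> /= /orP[hI|hI] /orP[hJ|hJ] _ _ /negP dIJ.
- by apply: (IHl a) => //; apply/negP.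
- by case: dIJ; apply: itv_disjoint (tree_weights_sub hI) (tree_weights_sub hJ).
- case: dIJ; rewrite disjoint_sym.
  exact: itv_disjoint (tree_weights_sub hJ) (tree_weights_sub hI).
- by apply: (IHr (a + leaves l)%N) => //; apply/negP.
Qed.

Lemma represents_ext Y Y' T a : (a + leaves T <= n)%N ->
  (forall I, I \subset itv n a (a + leaves T) -> Y I = Y' I) ->
  represents Y T a -> represents Y' T a.
Proof.
elim: T a => [y|w l IHl r IHr] a an YY' /=.
  by rewrite -YY' // addn1.
rewrite /= in an YY'; move=> [Yw rl rr H]; split.
- by rewrite -YY'.
- apply: IHl rl; [lia | move=> I hI; apply: YY'].
  by apply: fintype.subset_trans hI _; apply: itv_sub; lia.
- apply: IHr rr; [lia | move=> I hI; apply: YY'].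
  by apply: fintype.subset_trans hI _; apply: itv_sub; lia.
- by move=> I + hI; rewrite -YY' // => /H; apply.
Qed.

(** The weights of the two subtrees live on subsets of disjoint intervals and never on the whole
    interval, so the three summands do not interfere. *)
Lemma tree_weights_represents T a : (a + leaves T <= n)%N ->
  represents (tree_weights T a) T a.
Proof.
elim: T a => [y|w l IHl r IHr] a an /=; first by rewrite eqxx.
rewrite /= in an; have lpos := leaves_gt0 l; have rpos := leaves_gt0 r.
set b := (a + (leaves l + leaves r))%N in an *; set c := (a + leaves l)%N.
have bE : (c + leaves r = b)%N by rewrite /b /c addnA.
have off U d I : (d + leaves U <= n)%N -> ~~ (I \subset itv n d (d + leaves U)) ->
    tree_weights U d I = 0%N.
  move=> dn nI; apply/eqP; rewrite -leqn0 leqNgt; apply: contra nI.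
  exact: tree_weights_sub.
have z U : (forall d, (d + leaves U <= n)%N -> tree_weights U d finset.set0 = 0%N).
  move=> d dn; apply/eqP; rewrite -leqn0 leqNgt; apply/negP => /(tree_weights_neq0 dn).
  by rewrite eqxx.
have nab I : I \subset itv n a c -> (I == itv n a b) = false.
  by move=> h; apply: contraTF h => /eqP->; rewrite itv_subP /c /b; lia.
have ncb I : I \subset itv n c b -> (I == itv n a b) = false.
  by move=> h; apply: contraTF h => /eqP->; rewrite itv_subP /c /b; lia.
have excl I : I \subset itv n a c -> I \subset itv n c b -> I = finset.set0.
  move=> h1 h2; have := itv_disjoint h1 h2.
  by rewrite -setI_eq0 finset.setIid => /eqP.
split.
- rewrite eqxx !off ?addn0 ?bE //; try (rewrite /c /b in an *; lia).
    by rewrite itv_subP /c /b; lia.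
  by rewrite itv_subP /c /b; lia.
- apply: represents_ext (IHl a _); try (rewrite /b in an; lia).
  move=> I hI; rewrite nab //= add0n.
  case: (eqVneq I finset.set0) => [->|I0].
    by rewrite !z //; rewrite /b /c in an *; lia.
  rewrite [tree_weights r _ _]off ?addn0 ?bE //.
  by apply: contra I0 => /(excl _ hI) ->.
- apply: represents_ext (IHr c _); try (rewrite bE; done).
  move=> I; rewrite bE => hI; rewrite ncb //= add0n.
  case: (eqVneq I finset.set0) => [->|I0].
    by rewrite !z //; rewrite /b /c in an *; lia.
  rewrite [tree_weights l _ _]off ?add0n //; first by rewrite /b in an; lia.
  by apply: contra I0 => /excl -> .
- move=> I + hI; rewrite !addn_gt0; case: eqP => [->|_] /=; first by constructor 1.
  case/orP => /tree_weights_sub; first by constructor 2.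
  by rewrite bE; constructor 3.
Qed.

(** The interval is cut at the end [c] of its longest proper initial interval of positive weight. An
    interval straddling [c] meets that initial interval, so by nesting it contains it, and by
    maximality it is the whole interval. The right part may have weight 0. *)
Lemma exists_represents Y a d :
  (forall I, (0 < Y I)%N -> exists i j, [/\ I = itv n i j, (i < j)%N & (j <= n)%N]) ->
  (forall i : 'I_n, 0 < Y [set i]%SET)%N ->
  (forall I J, (0 < Y I)%N -> (0 < Y J)%N -> ~~ [disjoint I & J] ->
     I \subset J \/ J \subset I) ->
  (a + d.+1 <= n)%N -> exists T, leaves T = d.+1 /\ represents Y T a.
Proof.
move=> Yitv Y1 Ynest; elim/ltn_ind: d => d IH in a *; move=> an.
have ha : (a < n)%N by lia.
have Ya : (0 < Y (itv n a a.+1))%N by rewrite (itv1 ha).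
case: d IH an => [|d] IH an.
  by exists (Leaf (Y (itv n a a.+1)).-1); rewrite /= prednK.
set b := (a + d.+2)%N in an.
(* [c]: the end of the largest proper interval starting at [a] *)
pose p c := [&& (a < c)%N, (c < b)%N & (0 < Y (itv n a c))%N].
have ex_p : exists c, p c by exists a.+1; rewrite /p Ya /b; lia.
have p_ub c : p c -> (c <= b)%N by rewrite /p; lia.
case: (ex_maxnP ex_p p_ub) => c /and3P[ac cb Yc] cmax.
have [||T1 [l1 r1]] := IH (c - a).-1 _ a; [lia | lia |].
have [||T2 [l2 r2]] := IH (b - c).-1 _ c; [lia | lia |].
have E1 : (a + leaves T1 = c)%N by rewrite l1; lia.
have E2 : (leaves T1 + leaves T2 = d.+2)%N by rewrite l1 l2 /b; rewrite /b in cb; lia.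
exists (Node (Y (itv n a b)) T1 T2); rewrite /= E2 E1 -/b; split=> //; split=> //.
move=> I YI; have [i [j [E ij jn]]] := Yitv I YI; rewrite {}E in YI *.
rewrite itv_subP // => /andP[ai jb].
case: (leqP j c) => jc; first by constructor 2; apply: itv_sub.
case: (leqP c i) => ci; first by constructor 3; apply: itv_sub.
constructor 1.
have nd : ~~ [disjoint itv n i j & itv n a c].
  have hi : (i < n)%N by lia.
  apply/pred0Pn; exists (Ordinal hi); rewrite /= !mem_itv /=; lia.
have [] := Ynest _ _ YI Yc nd; rewrite itv_subP; try lia.
move=> /andP[ia _]; have {ia ai} Ei : i = a by lia.
subst i; case: (eqVneq j b) => [->//|jb'].
by have := cmax j; rewrite /p YI; lia.
Qed.

End TreesOfBuildingSets.

(** * Real-rooted polynomials are log-concave *)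

Section LogConcavity.
Variable R : realType.
Implicit Types p q : {poly R}.

(* Stronger than log-concavity of a nonnegative sequence (no internal zeros),
   and stable under multiplication by ['X + r], [r >= 0]. *)
Definition pf2 p : Prop := (forall i, 0 <= p`_i) /\
  forall i j, (i <= j)%N -> p`_i * p`_j.+2 <= p`_i.+1 * p`_j.+1.

Lemma pf2_mulXaddC p (r : R) : 0 <= r -> pf2 p -> pf2 (p * ('X + r%:P)).
Proof.
move=> r0 [p0 pp].
have cE i : (p * ('X + r%:P))`_i = (if i is i'.+1 then p`_i' else 0) + p`_i * r.
  by rewrite mulrDr coefD coefMX coefMC; case: i.
split=> [i|i j ij]; first by rewrite cE addr_ge0 ?mulr_ge0 //; case: i.
rewrite !cE.
have h2 := pp i j ij.
have hr2 : 0 <= r * r by rewrite mulr_ge0.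
have H2 : 0 <= r * r * (p`_i.+1 * p`_j.+1 - p`_i * p`_j.+2).
  by rewrite mulr_ge0 // subr_ge0.
case: i j ij h2 H2 => [|i] [|j] // ij h2 H2; rewrite ?add0r.
- have a := mulr_ge0 (p0 0%N) (p0 0%N).
  have b := mulr_ge0 r0 (mulr_ge0 (p0 0%N) (p0 1%N)).
  rewrite -subr_ge0.
  have -> : (p`_0 + p`_1 * r) * (p`_0 + p`_1 * r) - p`_0 * r * (p`_1 + p`_2 * r)
    = r * r * (p`_1 * p`_1 - p`_0 * p`_2) + p`_0 * p`_0 + (r * (p`_0 * p`_1)) by ring.
  by rewrite !addr_ge0.
- have a := mulr_ge0 (p0 0%N) (p0 j.+1).
  have b := mulr_ge0 r0 (mulr_ge0 (p0 1%N) (p0 j.+1)).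
  rewrite -subr_ge0.
  have -> : (p`_0 + p`_1 * r) * (p`_j.+1 + p`_j.+2 * r) -
     p`_0 * r * (p`_j.+2 + p`_j.+3 * r) =
    r * r * (p`_1 * p`_j.+2 - p`_0 * p`_j.+3) + p`_0 * p`_j.+1 + r * (p`_1 * p`_j.+1) by ring.
  by rewrite !addr_ge0.
rewrite ltnS in ij; have h3 := pp i j ij.
(* The coefficient of [r] needs p_i p_(j+3) <= p_(i+2) p_(j+1), reached through p_(i+1) p_(j+2). *)
have h4 := pp i j.+1 (leqW ij).
have h5 : p`_i.+1 * p`_j.+2 <= p`_i.+2 * p`_j.+1.
  by move: ij; rewrite leq_eqVlt => /orP[/eqP->|/pp//]; rewrite mulrC.
rewrite -subr_ge0.
have -> : (p`_i.+1 + p`_i.+2 * r) * (p`_j.+1 + p`_j.+2 * r) -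
    (p`_i + p`_i.+1 * r) * (p`_j.+2 + p`_j.+3 * r) =
  r * r * (p`_i.+2 * p`_j.+2 - p`_i.+1 * p`_j.+3)
  + (p`_i.+1 * p`_j.+1 - p`_i * p`_j.+2)
  + r * (p`_i.+2 * p`_j.+1 - p`_i * p`_j.+3) by ring.
apply: addr_ge0; first by rewrite addr_ge0 // subr_ge0.
by rewrite mulr_ge0 // subr_ge0 (le_trans h4 h5).
Qed.

(** Induction on the degree: each root x <= 0 splits off a factor X + r with r = - x >= 0. *)
Lemma pf2_real_rooted p : p != 0 -> 0 <= lead_coef p ->
  (forall z : R[i], root (map_poly (real_complex R) p) z ->
     exists2 x : R, x <= 0 & z = real_complex R x) -> pf2 p.
Proof.
move En : (size p) => n; elim: n p En => [|n IH] p En p0 lp rp.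
  by move/eqP: En; rewrite size_poly_eq0 (negbTE p0).
case: (posnP n) => [n0|n0].
  have /size_poly1P[c c0 Ep] : size p == 1%N by rewrite En n0.
  rewrite Ep lead_coefC in lp *; split=> [i|i j _]; rewrite !coefC; first by case: i.
  by rewrite /= mulr0 mulr_ge0 //; case: i.
have /closed_rootP[z rz] : size (map_poly (real_complex R) p) != 1%N.
  by rewrite size_map_poly En eqSS -lt0n.
have [x x0 Ez] := rp z rz.
have : root p x by move: rz; rewrite Ez fmorph_root.
move=> /factor_theorem[q Eq].
have q0 : q != 0 by apply: contraNneq p0; rewrite Eq => ->; rewrite mul0r.
have -> : p = q * ('X + (- x)%:P) by rewrite Eq polyCN.
apply: pf2_mulXaddC; first by rewrite oppr_ge0.
apply: IH => //.
- by move: En; rewrite Eq size_Mmonic ?monicXsubC // size_XsubC addn2 => -[].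
- by move: lp; rewrite Eq lead_coef_Mmonic ?monicXsubC.
- by move=> w rw; apply: rp; rewrite Eq rmorphM /= rootM rw.
Qed.

(** A nonzero polynomial with nonnegative coefficients is positive at every positive number, so its
    real roots are at most 0. *)
Lemma real_rooted_log_concave p : (forall i, 0 <= p`_i) ->
  real_rooted p -> log_concave p.
Proof.
move=> pge [->|rp]; first by move=> i; rewrite !coef0 mulr0 expr0n.
case: (eqVneq p 0) => [->|p0]; first by move=> i; rewrite !coef0 mulr0 expr0n.
have [_ H] : pf2 p.
  apply: pf2_real_rooted => // [|z rz]; first by rewrite lead_coefE.
  have Ez : z = real_complex R (complex.Re z).
    by move: (rp z rz); case: (z) => a b /= ->.
  exists (complex.Re z) => //; rewrite leNgt; apply/negP => z0.
  move: rz; rewrite Ez fmorph_root => /eqP; apply/eqP; rewrite gt_eqF //.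
  rewrite horner_coef -(prednK (_ : 0 < size p)%N) ?size_poly_gt0 // big_ord_recr /=.
  apply: ltr_wpDl; first by apply: sumr_ge0 => i _; rewrite mulr_ge0 ?exprn_ge0 ?(ltW z0).
  by rewrite mulr_gt0 ?exprn_gt0 // lt0r pge andbT -lead_coefE lead_coef_eq0.
by move=> i; rewrite expr2; apply: H.
Qed.

End LogConcavity.

(** * Fertility polynomials and nestohedra *)

Lemma tree_poly_ge0 (R : realType) (T : tree) (c i : nat) : 0 <= (tree_poly R T c)`_i.
Proof.
elim: T c i => [y|w l IHl r IHr] c i; rewrite /= coef_sum; apply: sumr_ge0 => j _.
  by rewrite coefZ coefXn !mulr_ge0 ?invr_ge0.
by rewrite coefM; apply: sumr_ge0 => m _; apply: mulr_ge0.
Qed.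

Section NestohedraTrees.
Variables (R : realType) (k : nat).

Lemma is_intervalE (I : {set 'I_k.+1}) : I != finset.set0 -> is_interval I ->
  exists i j, [/\ I = itv k.+1 i j, (i < j)%N & (j <= k.+1)%N].
Proof.
move=> /finset.set0Pn[m mI] [i [j E]]; exists i, j.+1; split=> //.
by move: mI; rewrite E inE => /andP[im mj]; rewrite ltnS (leq_trans im).
Qed.

Lemma nestohedron_of_tree (T : tree) : leaves T = k.+1 ->
  exists P : set 'rV[R]_k.+1,
    integral_binary_nestohedron P /\ lattice_poly P = tree_poly R T 0.
Proof.
move=> lT; pose Y : {set 'I_k.+1} -> nat := tree_weights T 0.
have T_le : (0 + leaves T <= k.+1)%N by rewrite lT.
have Y0 : Y finset.set0 = 0%N.
  apply/eqP; rewrite -leqn0 leqNgt; apply/negP => /(tree_weights_neq0 T_le).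
  by rewrite eqxx.
exists (nestohedron Y); split; last first.
  by apply: lattice_poly_tree => //; apply: tree_weights_represents.
split; last by move=> x; apply: vertex_integral.
exists (weight_support Y), (fun I => (Y I)%:R); split=> //; last first.
  by move=> I; rewrite inE ltr0n.
split=> [I|I|i|I J]; rewrite !inE.
- exact: tree_weights_neq0.
- move=> /tree_weights_itv[i [j [-> _ ij]]]; rewrite lT add0n => jk.
  have hi : (i < k.+1)%N by lia.
  have hj : (j.-1 < k.+1)%N by lia.
  exists (Ordinal hi), (Ordinal hj); apply/finset.setP => m; rewrite !inE /=; lia.
- by apply: tree_weights1; rewrite lT /=.
- exact: tree_weights_nested.
Qed.

(** Integral vertices force integral weights, so the positive real weights can be replaced by
    natural numbers. *)
Lemma tree_of_nestohedron (P : set 'rV[R]_k.+1) : integral_binary_nestohedron P ->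
  exists T : tree, lattice_poly P = tree_poly R T 0.
Proof.
move=> [[B [y [[B0 Bitv B1 Bnest] y0 EP]]] vP].
have yint : forall I, I \in B -> y I \is a Num.int.
  by apply: integral_weights => //; rewrite -EP.
pose Y I := if I \in B then Num.truncn (y I) else 0%N.
have YE I : I \in B -> (Y I)%:R = y I.
  move=> IB; rewrite /Y IB truncnK // natrEint yint //=; exact/ltW/y0.
have BY I : (0 < Y I)%N = (I \in B).
  apply/idP/idP => [|IB]; first by rewrite /Y; case: ifP.
  by rewrite -(ltr0n R) YE ?y0.
have EB : B = weight_support Y by apply/finset.setP => I; rewrite inE BY.
have Y0 : Y finset.set0 = 0%N.
  by apply/eqP; rewrite -leqn0 leqNgt BY; apply/negP => /B0; rewrite eqxx.
have -> : P = nestohedron Y.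
  rewrite EP /nestohedron -EB; apply/seteqP; split=> x [v [vs ->]];
    exists v; split=> //; apply: eq_bigr => I IB; by rewrite YE.
have [||||T [lT rT]] := @exists_represents k.+1 Y 0 k.
- by move=> I; rewrite BY => IB; apply: is_intervalE; [exact: B0 | exact: Bitv].
- by move=> i; rewrite BY.
- by move=> I J; rewrite !BY; apply: Bnest.
- by [].
by exists T; apply: lattice_poly_tree.
Qed.

End NestohedraTrees.

Theorem corollary3p3 (R : realType) :
  [/\ (forall p : seq nat, is_permutation p -> real_rooted (preimage_poly R p))
      <->
      (forall (k : nat) (P : set 'rV[R]_k.+1),
         integral_binary_nestohedron P -> real_rooted (lattice_poly P)),
      forall p : seq nat, is_permutation p ->
        real_rooted (preimage_poly R p) -> log_concave (preimage_poly R p)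
    & forall (k : nat) (P : set 'rV[R]_k.+1),
        integral_binary_nestohedron P ->
        real_rooted (lattice_poly P) -> log_concave (lattice_poly P)].
Proof.
have tree_rooted (T : tree) :
    (forall (k : nat) (P : set 'rV[R]_k.+1),
       integral_binary_nestohedron P -> real_rooted (lattice_poly P)) ->
    real_rooted (tree_poly R T 0).
  have lT : leaves T = (leaves T).-1.+1 by rewrite prednK ?leaves_gt0.
  by move=> H; have [P [/H + <-]] := nestohedron_of_tree R lT.
split; first split.
- move=> H k P /tree_of_nestohedron[T ->].
  (* The lower bound 1 makes the entries positive. *)
  have [L [d [uL L1 _ E]]] := tree_fertility_poly R T 1.
  have := H (rcons L d) (introT andP (conj uL L1)).
  by rewrite preimage_polyE ?/is_permutation ?uL // -[rcons L d]cats0 E.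
- move=> H p pp; rewrite preimage_polyE //; case: (p =P [::]) => [->|/eqP p0].
    (* The empty permutation has polynomial x, which is also that of a single leaf. *)
    have -> : fertility_poly R [::] = tree_poly R (Leaf 0) 0; last exact: tree_rooted.
    by rewrite fertility_poly_nil /= /narayana big_nat1 !mulr1 invr1 scale1r.
  have /andP[up _] := pp; have [T [o E]] := fertility_poly_tree R up p0.
  have := E [::] isT; rewrite cats0 /= => -> //.
  (* A positive offset means that the polynomial is 0, which counts as real-rooted. *)
  by case: o {E} => [|o] /=; [exact: tree_rooted | left].
- move=> p pp; apply: real_rooted_log_concave; rewrite preimage_polyE // => i.
  by rewrite coef_sum; apply: sumr_ge0 => s _; rewrite coefXn.
- move=> k P hP; apply: real_rooted_log_concave.
  by have [T ->] := tree_of_nestohedron hP; move=> i; apply: tree_poly_ge0.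
Qed.
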